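(* Let $m\ge2$, let $G(x)$ be an $m\times m$ symmetric polynomial matrix in $x=(x_1,\dots,x_n)$ of degree $d_G$, and let $K=\{x\in\mathbb{R}^n\mid G(x)\succeq0\}$. Let $\eta$ be the {\L}ojasiewicz exponent associated with the homogenized set $\widetilde K$ (defined in the context). Suppose $F(x)$ is an $\ell\times\ell$ symmetric polynomial matrix with $\deg(F)=d$. If $F(x)\succeq0$ for all $x\in K$, then there exists a constant $C>0$, depending on $F$ and $G$, such that for every $\varepsilon>0$, $$(1+\|x\|_2^2)^k\Big(F+\varepsilon\cdot(1+\|x\|_2^2)^{\lceil\frac{d+1}{2}\rceil}I_\ell\Big)\in\mathrm{QM}[G]^\ell_{\,2k+2\lceil\frac{d+1}{2}\rceil}$$ for every integer $k\ge C\cdot\varepsilon^{-7\eta-3}$.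
   Context: Degrees: the degree of a polynomial matrix is the maximum of the degrees of its entries; $d_G=\deg(G)$. $K$ is not assumed bounded. $|\alpha|$ denotes the sum of the entries of a multi-index $\alpha$. Quadratic modules: for an $m\times m$ symmetric polynomial matrix $G$ (in any set of variables $x$), $\mathrm{QM}[G]^\ell_k$ is the set of matrices $S+\sum_{i=1}^tP_i^TGP_i$ with $t\in\mathbb{N}$, $S$ a finite sum of matrices $Q^TQ$ with $Q\in\mathbb{R}[x]^{\ell\times\ell}$ and $2\deg(Q)\le k$, and $P_i\in\mathbb{R}[x]^{m\times\ell}$ with entries of degree at most $\lceil k/2-\deg(G)/2\rceil$. For $\ell=1$ write $\mathrm{QM}[G]_k$. The number $\theta(m)=\sum_{i=1}^m\Big(\prod_{k=m+1-i}^{m}\frac{k(k+1)}{2}\Big)$. Bernstein norm in $N$ variables $z=(z_1,\dots,z_N)$: for $t\in\mathbb{N}$ and $\alpha\in\mathbb{N}^N$ with $|\alpha|\le t$, let $$B^{(t)}_\alpha(z)=\frac{t!}{\alpha_1!\cdots\alpha_N!\,(t-|\alpha|)!}(N+\sqrt N)^{-t}(\sqrt N-z_1-\cdots-z_N)^{t-|\alpha|}(1+z_1)^{\alpha_1}\cdots(1+z_N)^{\alpha_N}.$$ A polynomial $p(z)$ of degree $r$ has a unique expansion $p=\sum_{|\alpha|\le r}p_\alpha B_\alpha^{(r)}$, and $\|p\|_B=\max_\alpha|p_\alpha|$. For polynomials in $\tilde x=(x_0,\dots,x_n)$, take $N=n+1$. {\L}ojasiewicz exponent: let $\tilde x=(x_0,x)\in\mathbb{R}^{n+1}$,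 let $\widetilde G(\tilde x)=\sum_{|\alpha|\le d_G}G_\alpha x^\alpha x_0^{d_G-|\alpha|}$ be the homogenization of $G=\sum_{|\alpha|\le d_G}G_\alpha x^\alpha$, let $d_0=2\lceil d_G/2\rceil-d_G$, $\widehat G(\tilde x)=x_0^{d_0}\widetilde G(\tilde x)$, and $\widetilde K=\{\tilde x\in\mathbb{R}^{n+1}\mid\widehat G(\tilde x)\succeq0,\ x_0^2+x^Tx=1\}$. Let $d_1,\dots,d_{\theta(m)}\in\mathrm{QM}[\widehat G]_{2\cdot3^{m-1}\lceil d_G/2\rceil}$ be polynomials in $\tilde x$ with $\{\tilde x\mid\widehat G(\tilde x)\succeq0\}=\{\tilde x\mid d_1(\tilde x)\ge0,\dots,d_{\theta(m)}(\tilde x)\ge0\}$ (such polynomials exist). Put $$\mathcal G(\tilde x)=-\min\left(\frac{d_1(\tilde x)}{\|d_1\|_B},\dots,\frac{d_{\theta(m)}(\tilde x)}{\|d_{\theta(m)}\|_B},\frac{1-\|\tilde x\|_2^2}{\|1-\|\tilde x\|_2^2\|_B},\frac{\|\tilde x\|_2^2-1}{\|1-\|\tilde x\|_2^2\|_B},0\right),$$ where a quotient with $d_i\equiv0$ is read as $0$. Let $d(\tilde x,\widetilde K)$ be the Euclidean distance from $\tilde x$ to $\widetilde K$ (this presupposes $\widetilde K\neq\emptyset$). The {\L}ojasiewicz exponent $\eta$ is the smallest positive constant for which there is $\kappa>0$ with $d(\tilde x,\widetilde K)^\eta\le\kappa\,\mathcal G(\tilde x)$ for all $\tilde x$ satisfying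 $\sqrt{n+1}-x_0-x_1-\cdots-x_n\ge0$, $1+x_0\ge0$, $1+x_1\ge0,\dots,1+x_n\ge0$. *)

(* Defs.v *)
(* Points of R^n are row vectors; in n + 1 variables, x_0 is the variable [ord0]
   and x_i (1 <= i <= n) is [lift ord0 (i - 1)]. *)
From mathcomp Require Import all_boot all_order all_algebra.
From mathcomp Require Import classical_sets reals exp.
From mathcomp Require Import mpoly.

Set Implicit Arguments.
Unset Strict Implicit.
Unset Printing Implicit Defensive.

Import Order.TTheory GRing.Theory Num.Theory.

Local Open Scope classical_set_scope.
Local Open Scope ring_scope.

(* Truncated predecessor: the zero polynomial gets degree 0. *)
Definition mpdeg (R : realType) (n : nat) (p : {mpoly R[n]}) : nat :=
  (msize p).-1.

Definition mxdeg (R : realType) (n p q : nat) (A : 'M[{mpoly R[n]}]_(p, q)) :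
  nat := \max_(i < p) \max_(j < q) mpdeg (A i j).

Definition mxeval (R : realType) (n p q : nat) (A : 'M[{mpoly R[n]}]_(p, q))
  (x : 'rV[R]_n) : 'M[R]_(p, q) := map_mx (meval (x 0)) A.

(* Only applied to symmetric matrices. *)
Definition psdmx (R : realType) (m : nat) (A : 'M[R]_m) : Prop :=
  forall v : 'cV[R]_m, 0 <= (v^T *m A *m v) 0 0.

Definition psd_set (R : realType) (n m : nat) (G : 'M[{mpoly R[n]}]_m) :
  set 'rV[R]_n := [set x | psdmx (mxeval G x)].

(* The truncated quadratic module QM[G]^l_k.  The bound on the entries of the
   P_i may be a negative integer (when k + 1 < deg G); then only the zero
   polynomial, whose degree is -oo here, satisfies it. *)
Definition QM (R : realType) (n m : nat) (G : 'M[{mpoly R[n]}]_m) (l k : nat) :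
  set 'M[{mpoly R[n]}]_l :=
  [set A | exists (s : nat) (Q : 'I_s -> 'M[{mpoly R[n]}]_l)
                  (t : nat) (P : 'I_t -> 'M[{mpoly R[n]}]_(m, l)),
    [/\ forall i, (2 * mxdeg (Q i) <= k)%N,
        forall i a b, P i a b != 0 ->
          (mpdeg (P i a b))%:Z
            <= Num.ceil (k%:R / 2%:R - (mxdeg G)%:R / 2%:R : R)
      & A = \sum_(i < s) (Q i)^T *m Q i + \sum_(i < t) (P i)^T *m G *m P i]].

Arguments QM {R n m} G l k.

Definition theta (m : nat) : nat :=
  (\sum_(1 <= i < m.+1) \prod_(m.+1 - i <= k < m.+1) ((k * k.+1) %/ 2))%N.

Definition bernstein (R : realType) (N t : nat) (a : 'X_{1..N}) :
  {mpoly R[N]} :=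
  (t`!%:R / ((\prod_(i < N) (a i)`!) * (t - mdeg a)`!)%N%:R
     * (N%:R + Num.sqrt N%:R) ^- t)
    *: (((Num.sqrt N%:R)%:MP - \sum_(i < N) 'X_i) ^+ (t - mdeg a)%N
        * \prod_(i < N) (1 + 'X_i) ^+ a i).

(* The coefficients of p in the Bernstein basis of degree deg p; they exist
   and are unique, so the default value of [xget] is irrelevant. *)
Definition bernstein_coef (R : realType) (N : nat) (p : {mpoly R[N]}) :
  {ffun 'X_{1..N < (mpdeg p).+1} -> R} :=
  xget [ffun=> 0]
    [set c : {ffun 'X_{1..N < (mpdeg p).+1} -> R} |
      p = \sum_(a : 'X_{1..N < (mpdeg p).+1}) c a *: bernstein R (mpdeg p) a].

Definition bernstein_norm (R : realType) (N : nat) (p : {mpoly R[N]}) : R :=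
  \big[Num.max/0]_(a : 'X_{1..N < (mpdeg p).+1}) `|bernstein_coef p a|.

Definition homogenize (R : realType) (n d : nat) (p : {mpoly R[n]}) :
  {mpoly R[n.+1]} :=
  \sum_(a <- msupp p)
    p@_a *: (\prod_(i < n) 'X_(lift ord0 i) ^+ a i * 'X_ord0 ^+ (d - mdeg a)%N).

Definition Gtilde (R : realType) (n m : nat) (G : 'M[{mpoly R[n]}]_m) :
  'M[{mpoly R[n.+1]}]_m := map_mx (homogenize (mxdeg G)) G.

(* [uphalf d] is the ceiling of d / 2. *)
Definition Ghat (R : realType) (n m : nat) (G : 'M[{mpoly R[n]}]_m) :
  'M[{mpoly R[n.+1]}]_m :=
  'X_ord0 ^+ (2 * uphalf (mxdeg G) - mxdeg G)%N *: Gtilde G.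

Definition Ktilde (R : realType) (n m : nat) (G : 'M[{mpoly R[n]}]_m) :
  set 'rV[R]_n.+1 :=
  [set x | psd_set (Ghat G) x /\ \sum_(i < n.+1) x 0 i ^+ 2 = 1].

Definition edist (R : realType) (N : nat) (x : 'rV[R]_N) (A : set 'rV[R]_N) :
  R := inf [set Num.sqrt (\sum_(i < N) (x 0 i - y 0 i) ^+ 2) | y in A].

(* Division by zero yields 0, so a zero [ds i] contributes 0 to the minimum. *)
Definition calG (R : realType) (N r : nat) (ds : 'I_r -> {mpoly R[N]})
  (x : 'rV[R]_N) : R :=
  let b : {mpoly R[N]} := 1 - \sum_(i < N) 'X_i ^+ 2 in
  - Num.min (\big[Num.min/0]_(i < r) ((ds i).@[x 0] / bernstein_norm (ds i)))
      (Num.min (b.@[x 0] / bernstein_norm b)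
        (Num.min ((- b).@[x 0] / bernstein_norm b) 0)).

Definition lojasiewicz_ineq (R : realType) (n m r : nat)
  (G : 'M[{mpoly R[n]}]_m) (ds : 'I_r -> {mpoly R[n.+1]}) (eta : R) : Prop :=
  exists2 kappa : R, 0 < kappa &
    forall x : 'rV[R]_n.+1,
      0 <= Num.sqrt n.+1%:R - \sum_(i < n.+1) x 0 i ->
      (forall i, 0 <= 1 + x 0 i) ->
      edist x (Ktilde G) `^ eta <= kappa * calG ds x.

Definition is_lojasiewicz_exponent (R : realType) (n m r : nat)
  (G : 'M[{mpoly R[n]}]_m) (ds : 'I_r -> {mpoly R[n.+1]}) (eta : R) : Prop :=
  [/\ 0 < eta, lojasiewicz_ineq G ds eta
    & forall eta' : R, 0 < eta' -> lojasiewicz_ineq G ds eta' -> eta <= eta'].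

(* Main.v *)
Require Import Defs.
From mathcomp Require Import all_boot all_order all_algebra.
From mathcomp Require Import classical_sets reals exp.
From mathcomp Require Import mpoly.
From mathcomp Require Import zify ring lra.

Set Implicit Arguments.
Unset Strict Implicit.
Unset Printing Implicit Defensive.

Import Order.TTheory GRing.Theory Num.Theory.
Local Open Scope classical_set_scope.
Local Open Scope ring_scope.

(** Let h be uphalf (d + 1), so that 2 h > deg F, and let f be the
    homogenization of F in degree 2 h.  On Ktilde the form f is positive
    semidefinite: where x_0 <> 0 it is an even power of x_0 times a value of F
    on K, and where x_0 = 0 it vanishes because 2 h exceeds the degree of F
    ([psd_homogenize]).

    It is enough to certify f + eps I on the unit sphere, that is, to write it
    there as a sum of terms Q^T Q and P^T Ghat P of degree at most 2 (k + h).
    Indeed, let s^2 = 1 + |x|^2 and evaluate at the points (1, x) / s and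
    - (1, x) / s of the sphere.  Multiplying by s^(2 k + 2 h) and averaging
    over the two signs of s leaves only even powers of s, which are polynomials
    in x, and each term becomes a sum of terms of the same shape
    ([QM_of_sphere]).

    The certificate on the sphere ([core_certificate]) is found on the larger
    simplex of the Lojasiewicz inequality.  Let the g_i be the d_i and the two
    signs of 1 - |z|^2, rescaled to take values in [-1, 1] on the simplex.
    Consider
      p = f + eps I - lam * sum_i w(g_i)^2 g_i I,
    where w(t) is the probability that a random walk with drift t ends below a
    threshold: a polynomial in t that is small for t >= 0 and close to
    1 for t <= - delta, by the Chebyshev inequality.  If no g_i is below
    - delta at z, then z is within O(delta^(1/eta)) of Ktilde, so f is nearly
    positive semidefinite at z ([lojasiewicz_qform]); otherwise one of the
    penalties outweighs f.  In both cases p >= eps / 2 on the simplex.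

    Write p in the barycentric coordinates y_a of the simplex as
      p = sum_w c_w y_(w_1) ... y_(w_D)
    over words w of length D.  Multiplying by (sum_a y_a)^(K - D) = 1 replaces
    the c_w by their averages over D letters drawn without replacement from an
    urn of K letters ([sampling_identity]).  Drawing with replacement would
    give the value of p at a point of the simplex, and the two averages differ
    by at most L D^2 / K when the c_w are bounded by L.  So the new coefficients
    are positive semidefinite once 2 D^2 L <= K eps ([sampling_ge0]).  Every
    y_a is a sum of squares of affine polynomials on the sphere ([bary_sos]),
    hence p is certified in degree K; the penalties are certified because the
    d_i are in the quadratic module and 1 - |z|^2 vanishes on the sphere.

    The exponent comes from delta ~ eps^eta, lam ~ 1 / delta, L ~ lam and a
    walk of length D ~ 1 / (delta^3 eps), for which D^2 L / eps is of order
    1 / (delta^7 eps^3).  The walk matters because its coefficients stay in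
    [0, 1] ([coef_tree_cvx]), whereas the coefficients of a power such as
    (1 - t)^D grow exponentially with D.  For large eps the exponent k may be
    small; then f + eps I is certified directly in the degree of f
    ([near_qm_poly]). *)

(** * Polynomials in a partition of unity *)

Section CoefficientTrees.
Variables (R : realFieldType) (A : finType) (Z : Type) (y : A -> Z -> R).

(** Unfolding the D rounds, phi = sum_w c_w y_(w_1) ... y_(w_D) over all words w
    of length D, with a coefficient c_w in [lo, hi] for each word.  When the
    letters y_a are barycentric coordinates, such a bound serves as a Bernstein
    norm; the recursive form turns each closure property into an induction on
    the length of the words. *)
Fixpoint coef_tree (D : nat) (lo hi : R) (phi : Z -> R) : Prop :=
  if D is D'.+1 then
    exists psi : A -> Z -> R, (forall a, coef_tree D' lo hi (psi a)) /\
      (forall z, phi z = \sum_a y a z * psi a z)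
  else exists c : R, lo <= c <= hi /\ forall z, phi z = c.

Lemma eq_coef_tree D lo hi phi phi' :
  phi =1 phi' -> coef_tree D lo hi phi -> coef_tree D lo hi phi'.
Proof.
case: D => [|D] e /=.
- by move=> [c [hc h]]; exists c; split=> // z; rewrite -e.
- by move=> [psi [hpsi h]]; exists psi; split=> // z; rewrite -e.
Qed.

Lemma coef_tree_wide D lo hi lo' hi' phi :
  lo' <= lo -> hi <= hi' -> coef_tree D lo hi phi -> coef_tree D lo' hi' phi.
Proof.
move=> hl hh; elim: D phi => [|D IH] phi /=.
- by move=> [c [/andP[h1 h2] h]]; exists c; split=> //; apply/andP; split; lra.
- by move=> [psi [hpsi h]]; exists psi; split=> // a; apply: IH.
Qed.

Lemma coef_treeZ D lo hi c phi :
  0 <= c -> coef_tree D lo hi phi -> coef_tree D (c * lo) (c * hi) (fun z => c * phi z).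
Proof.
move=> hc; elim: D phi => [|D IH] phi /=.
- move=> [b [/andP[h1 h2] h]]; exists (c * b); split=> [|z]; last by rewrite h.
  by rewrite !ler_wpM2l.
- move=> [psi [hpsi h]]; exists (fun a z => c * psi a z); split.
    by move=> a; apply: IH.
  by move=> z; rewrite h mulr_sumr; apply: eq_bigr => a _; ring.
Qed.

Lemma coef_treeN D L phi :
  coef_tree D (- L) L phi -> coef_tree D (- L) L (fun z => - phi z).
Proof.
elim: D phi => [|D IH] phi /=.
- move=> [b [/andP[h1 h2] h]]; exists (- b); split=> [|z]; last by rewrite h.
  by apply/andP; split; lra.
- move=> [psi [hpsi h]]; exists (fun a z => - psi a z); split.
    by move=> a; apply: IH.
  by move=> z; rewrite h -sumrN; apply: eq_bigr => a _; ring.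
Qed.

Lemma coef_treeD D lo hi lo' hi' phi phi' :
  coef_tree D lo hi phi -> coef_tree D lo' hi' phi' ->
  coef_tree D (lo + lo') (hi + hi') (fun z => phi z + phi' z).
Proof.
elim: D phi phi' => [|D IH] phi phi' /=.
- move=> [b [/andP[h1 h2] h]] [b' [/andP[h1' h2'] h']]; exists (b + b').
  by split=> [|z]; [apply/andP; split; lra|rewrite h h'].
- move=> [psi [hpsi h]] [psi' [hpsi' h']].
  exists (fun a z => psi a z + psi' a z); split=> [a|z]; first exact: IH.
  by rewrite h h' -big_split; apply: eq_bigr => a _ /=; ring.
Qed.

(** The second tree is grafted onto every leaf of the first, so the bounds
    multiply. *)
Lemma coef_treeM D D' L L' phi phi' : 0 <= L -> 0 <= L' ->
  coef_tree D (- L) L phi -> coef_tree D' (- L') L' phi' ->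
  coef_tree (D + D') (- (L * L')) (L * L') (fun z => phi z * phi' z).
Proof.
move=> hL hL' + h'; elim: D phi => [|D IH] phi.
- rewrite add0n /= -[X in X -> _]/(exists c, - L <= c <= L /\ forall z, phi z = c).
  move=> [c [+ h]]; rewrite -ler_norml => hc.
  apply: (@coef_tree_wide _ (- (`|c| * L')) (`|c| * L')).
  + by rewrite lerN2 ler_wpM2r.
  + by rewrite ler_wpM2r.
  have [c0|c0] := leP 0 c.
  + have := coef_treeZ c0 h'; rewrite mulrN ger0_norm //.
    by apply: eq_coef_tree => z; rewrite h.
  + have c0' : 0 <= - c by lra.
    rewrite ler0_norm; last exact: ltW.
    have := coef_treeZ c0' h'; rewrite mulrN => /coef_treeN H.
    by apply: eq_coef_tree H => z; rewrite h; ring.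
- rewrite addSn /= => -[psi [hpsi h]].
  exists (fun a z => psi a z * phi' z); split=> [a|z]; first exact: IH.
  by rewrite h mulr_suml; apply: eq_bigr => a _; ring.
Qed.

Hypothesis sum_y : forall z, \sum_a y a z = 1.

(** Since the letters have sum 1, a letter may be read and ignored. *)
Lemma coef_tree_lift k D lo hi phi :
  coef_tree D lo hi phi -> coef_tree (k + D) lo hi phi.
Proof.
move=> h; elim: k => // k IH; rewrite addSn /=.
exists (fun _ => phi); split=> // z.
by rewrite -mulr_suml sum_y mul1r.
Qed.

Lemma coef_tree_le D D' lo hi phi :
  (D <= D')%N -> coef_tree D lo hi phi -> coef_tree D' lo hi phi.
Proof. by move=> /subnK <-; apply: coef_tree_lift. Qed.

(** At each leaf of the tree of g the weights (1 + g) / 2 and (1 - g) / 2 are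
    nonnegative with sum 1, so the new coefficients are convex combinations of
    coefficients of phi and phi'. *)
Lemma coef_tree_cvx D e lo hi g phi phi' :
  coef_tree e (-1) 1 g -> coef_tree D lo hi phi -> coef_tree D lo hi phi' ->
  coef_tree (e + D) lo hi
    (fun z => (1 + g z) / 2 * phi z + (1 - g z) / 2 * phi' z).
Proof.
elim: e g => [|e IH] g.
- move=> [c [/andP[h1 h2] h]]; rewrite add0n.
  elim: D phi phi' => [|D IH] phi phi' /=.
    move=> [b [/andP[hb1 hb2] hb]] [b' [/andP[hb1' hb2'] hb']].
    exists ((1 + c) / 2 * b + (1 - c) / 2 * b'); split=> [|z].
      have c1 : 0 <= 1 + c by lra.
      have c2 : 0 <= 1 - c by lra.
      have := mulr_ge0 c1 (_ : 0 <= b - lo); have := mulr_ge0 c2 (_ : 0 <= b' - lo).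
      have := mulr_ge0 c1 (_ : 0 <= hi - b); have := mulr_ge0 c2 (_ : 0 <= hi - b').
      rewrite !subr_ge0 => /(_ hb2') H1 /(_ hb2) H2 /(_ hb1') H3 /(_ hb1) H4.
      by apply/andP; split; lra.
    by rewrite h hb hb'.
  move=> [psi [hpsi h3]] [psi' [hpsi' h3']].
  exists (fun a z => (1 + g z) / 2 * psi a z + (1 - g z) / 2 * psi' a z).
  split=> [a|z]; first exact: IH.
  rewrite h3 h3' !mulr_sumr -big_split /=; apply: eq_bigr => a _; ring.
- move=> [psi [hpsi h]] hA hB; rewrite addSn /=.
  exists (fun a z => (1 + psi a z) / 2 * phi z + (1 - psi a z) / 2 * phi' z).
  split=> [a|z]; first exact: IH (hpsi a) hA hB.
  have -> : (1 + g z) / 2 * phi z + (1 - g z) / 2 * phi' z =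
    (phi z + phi' z) / 2 + (phi z - phi' z) / 2 * g z by field.
  have -> : (phi z + phi' z) / 2 = \sum_a y a z * ((phi z + phi' z) / 2).
    by rewrite -mulr_suml sum_y mul1r.
  rewrite h mulr_sumr -big_split /=.
  by apply: eq_bigr => a _; field.
Qed.

Lemma coef_tree_cst c L : `|c| <= L -> coef_tree 0 (- L) L (fun=> c).
Proof. by rewrite ler_norml => h; exists c. Qed.

Lemma coef_tree_letter a : coef_tree 1 (-1) 1 (y a).
Proof.
exists (fun b _ => (b == a)%:R); split.
  by move=> b; exists (b == a)%:R; split=> //; case: (b == a) => /=; apply/andP; split; lra.
move=> z; rewrite (bigD1 a) //= eqxx mulr1 big1 ?addr0 // => b /negPf ->.
by rewrite mulr0.
Qed.

Lemma coef_tree_range D lo hi phi z : (forall a, 0 <= y a z) ->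
  coef_tree D lo hi phi -> lo <= phi z <= hi.
Proof.
move=> hy; elim: D phi => [|D IH] phi /=; first by move=> [c [h ->]].
move=> [psi [hpsi ->]].
have h a : lo <= psi a z <= hi by apply: IH.
rewrite -[lo]mul1r -[hi]mul1r -(sum_y z) !mulr_suml.
by apply/andP; split; apply: ler_sum => a _; rewrite ler_wpM2l //; have /andP[] := h a.
Qed.

(** Each of the D rounds of averaging contributes at most L times the distance
    of the letters. *)
Lemma coef_tree_lipschitz D L phi z z' :
  (forall a, 0 <= y a z) -> (forall a, 0 <= y a z') ->
  coef_tree D (- L) L phi ->
  `|phi z - phi z'| <= D%:R * L * \sum_a `|y a z - y a z'|.
Proof.
move=> hy hy'; elim: D phi => [|D IH] phi.
  by move=> [c [_ h]]; rewrite !h subrr normr0 !mul0r.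
move=> [psi [hpsi h]]; rewrite !h -sumrB.
have -> : \sum_a (y a z * psi a z - y a z' * psi a z') =
  \sum_a y a z * (psi a z - psi a z') + \sum_a (y a z - y a z') * psi a z'.
  by rewrite -big_split /=; apply: eq_bigr => a _; ring.
rewrite -natr1 mulrDl mul1r mulrDl; apply: le_trans (ler_normD _ _) _.
apply: lerD; apply: le_trans (ler_norm_sum _ _ _) _.
  have -> : D%:R * L * \sum_a `|y a z - y a z'| =
    \sum_a y a z * (D%:R * L * \sum_b `|y b z - y b z'|).
    by rewrite -mulr_suml sum_y mul1r.
  apply: ler_sum => a _.
  by rewrite normrM ger0_norm //; apply: ler_wpM2l => //; exact: IH (hpsi a).
rewrite mulr_sumr; apply: ler_sum => a _; rewrite normrM mulrC ler_wpM2r //.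
by rewrite ler_norml; apply: coef_tree_range hy' _; apply: hpsi.
Qed.

End CoefficientTrees.

(** * A polynomial threshold *)

Section Threshold.
Variable R : realFieldType.

(** The probability that a walk started at s ends at or below 0 after m
    independent steps, each of them +1 with probability (1 + t) / 2 and -1 with
    probability (1 - t) / 2.  As a polynomial in t it approximates the
    indicator function of the t below - s / m. *)
Fixpoint walk (m : nat) (s t : R) : R :=
  if m is m'.+1 then
    (1 + t) / 2 * walk m' (s + 1) t + (1 - t) / 2 * walk m' (s - 1) t
  else (s <= 0)%R%:R.

Lemma coef_tree_walk (A : finType) (Z : Type) (y : A -> Z -> R)
    (sum_y : forall z, \sum_a y a z = 1) m s e g :
  coef_tree y e (-1) 1 g -> coef_tree y (m * e) 0 1 (fun z => walk m s (g z)).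
Proof.
move=> hg; elim: m s => [|m IH] s /=.
  by exists (s <= 0)%R%:R; split=> //; case: (s <= 0) => /=; apply/andP; split; lra.
by rewrite mulSn; apply: coef_tree_cvx.
Qed.

Lemma walk_range m s t : -1 <= t <= 1 -> 0 <= walk m s t <= 1.
Proof.
move=> /andP[h1 h2]; elim: m s => [|m IH] s /=.
  by case: (s <= 0) => /=; apply/andP; split; lra.
have /andP[? ?] := IH (s + 1); have /andP[? ?] := IH (s - 1).
by apply/andP; split; nra.
Qed.

(** Chebyshev inequality: (x - a)^2 is at least a^2 for x <= 0, and the right
    side is the mean of (x - a)^2 over the end points x of the walk.  Both sides
    satisfy the recursion of [walk]. *)
Lemma walk_le_quad m s t a : -1 <= t <= 1 -> 0 <= a ->
  walk m s t * a ^+ 2 <= (s + m%:R * t - a) ^+ 2 + m%:R * (1 - t ^+ 2).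
Proof.
move=> /andP[h1 h2] a0; elim: m s => [|m IH] s /=.
  rewrite !mul0r !addr0; have [s0|s0] := leP s 0; last by rewrite mul0r sqr_ge0.
  by rewrite mul1r; have := mulr_le0_ge0 s0 a0; have := sqr_ge0 s; nra.
have := IH (s + 1); have := IH (s - 1); rewrite -(natr1 m); set q := m%:R.
set W := walk _ _ _; set W' := walk _ _ _ => H H'.
have e : (s + (q + 1) * t - a) ^+ 2 + (q + 1) * (1 - t ^+ 2) =
  (1 + t) / 2 * ((s + 1 + q * t - a) ^+ 2 + q * (1 - t ^+ 2)) +
  (1 - t) / 2 * ((s - 1 + q * t - a) ^+ 2 + q * (1 - t ^+ 2)) by field.
rewrite e mulrDl -!mulrA lerD // ler_wpM2l //; lra.
Qed.

(** Chebyshev inequality for the end points above 0. *)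
Lemma walk_ge_quad m s t a : -1 <= t <= 1 -> a <= 0 ->
  (1 - walk m s t) * a ^+ 2 <= (s + m%:R * t - a) ^+ 2 + m%:R * (1 - t ^+ 2).
Proof.
move=> /andP[h1 h2] a0.
elim: m s => [|m IH] s /=.
  rewrite !mul0r !addr0; have [s0|s0] := leP s 0; first by rewrite subrr mul0r sqr_ge0.
  by rewrite subr0 mul1r; have := mulr_ge0_le0 (ltW s0) a0; have := sqr_ge0 s; nra.
have := IH (s + 1); have := IH (s - 1); rewrite -(natr1 m); set q := m%:R.
set W := walk _ _ _; set W' := walk _ _ _ => H H'.
have e : (s + (q + 1) * t - a) ^+ 2 + (q + 1) * (1 - t ^+ 2) =
  (1 + t) / 2 * ((s + 1 + q * t - a) ^+ 2 + q * (1 - t ^+ 2)) +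
  (1 - t) / 2 * ((s - 1 + q * t - a) ^+ 2 + q * (1 - t ^+ 2)) by field.
have -> : (1 - ((1 + t) / 2 * W' + (1 - t) / 2 * W)) * a ^+ 2 =
  (1 + t) / 2 * ((1 - W') * a ^+ 2) + (1 - t) / 2 * ((1 - W) * a ^+ 2) by field.
rewrite e lerD // ler_wpM2l //; lra.
Qed.

(** Taking for a the mean s + m t of the end point, which is at least m d / 2,
    leaves the variance m (1 - t^2) as the only error. *)
Lemma walk_small m d t : 0 < d -> 0 <= t <= 1 ->
  walk m (m%:R * d / 2) t * (m%:R * d ^+ 2) <= 4.
Proof.
move=> d0 /andP[t0 t1]; have [->|m0] := posnP m; first by rewrite !mul0r mulr0.
have m0' : 0 < m%:R :> R by rewrite ltr0n.
set q := m%:R in m0' *; set s := q * d / 2.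
have ht : -1 <= t <= 1 by apply/andP; split; lra.
have /andP[w0 _] := walk_range m s ht.
have a0 : 0 <= q * (d / 2 + t) by nra.
have := walk_le_quad m s ht a0; set w := walk _ _ _ in w0 *.
have -> : s + q * t - q * (d / 2 + t) = 0 by rewrite /s; field.
rewrite expr0n /= add0r => H.
have {}H : q * (w * (q * (d / 2 + t) ^+ 2)) <= q * 1.
  apply: (@le_trans _ _ (q * (1 - t ^+ 2))); last by nra.
  by apply: le_trans H; rewrite le_eqVlt; apply/orP; left; apply/eqP; ring.
rewrite ler_pM2l // in H.
suff : w * (q * (d / 2) ^+ 2) <= w * (q * (d / 2 + t) ^+ 2).
  by move: H; rewrite -/q; nra.
by rewrite ler_wpM2l // ler_wpM2l ?(ltW m0') //; nra.
Qed.

(** Here the mean of the end point is at most - m d / 2. *)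
Lemma walk_large m d t : 0 < d -> -1 <= t <= - d ->
  (1 - walk m (m%:R * d / 2) t) * (m%:R * d ^+ 2) <= 4.
Proof.
move=> d0 /andP[t1 t2]; have [->|m0] := posnP m; first by rewrite !mul0r mulr0.
have m0' : 0 < m%:R :> R by rewrite ltr0n.
set q := m%:R in m0' *; set s := q * d / 2.
have ht : -1 <= t <= 1 by apply/andP; split; lra.
have /andP[_ w1] := walk_range m s ht.
have a0 : q * (d / 2 + t) <= 0 by nra.
have := walk_ge_quad m s ht a0; set w := walk _ _ _ in w1 *.
have -> : s + q * t - q * (d / 2 + t) = 0 by rewrite /s; field.
rewrite expr0n /= add0r => H.
have {}H : q * ((1 - w) * (q * (d / 2 + t) ^+ 2)) <= q * 1.
  apply: (@le_trans _ _ (q * (1 - t ^+ 2))); last by nra.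
  by apply: le_trans H; rewrite le_eqVlt; apply/orP; left; apply/eqP; ring.
rewrite ler_pM2l // in H.
suff : (1 - w) * (q * (d / 2) ^+ 2) <= (1 - w) * (q * (d / 2 + t) ^+ 2).
  by move: H; rewrite -/q; nra.
by rewrite ler_wpM2l ?subr_ge0 // ler_wpM2l ?(ltW m0') //; nra.
Qed.

End Threshold.

(** * Sampling without replacement *)

Lemma big_ffun_ord_recl (R : realFieldType) (A : finType) (D : nat)
    (f : {ffun 'I_D.+1 -> A} -> R) :
  \sum_w f w = \sum_a \sum_(w : {ffun 'I_D -> A})
    f [ffun i => if unlift ord0 i is Some j then w j else a].
Proof.
rewrite pair_bigA /=.
pose h (p : A * {ffun 'I_D -> A}) : {ffun 'I_D.+1 -> A} :=
  [ffun i => if unlift ord0 i is Some j then p.2 j else p.1].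
rewrite (reindex h) //=.
exists (fun w : {ffun 'I_D.+1 -> A} => (w ord0, [ffun j => w (lift ord0 j)])).
- move=> [a w] _ /=; rewrite /h !ffunE unlift_none /=; congr (_, _).
  by apply/ffunP => j; rewrite !ffunE liftK.
- move=> w _; apply/ffunP => i; rewrite /h !ffunE /=.
  by case: unliftP => [j ->|->]; rewrite ?ffunE.
Qed.

Lemma coef_tree_words (R : realFieldType) (A : finType) (Z : Type)
    (y : A -> Z -> R) D lo hi phi :
  coef_tree y D lo hi phi ->
  exists c : {ffun 'I_D -> A} -> R, (forall w, lo <= c w <= hi) /\
    forall z, phi z = \sum_(w : {ffun 'I_D -> A}) (\prod_j y (w j) z) * c w.
Proof.
elim: D phi => [|D IH] phi.
  move=> [c [hc h]]; exists (fun=> c); split=> // z.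
  rewrite h -mulr_suml (eq_bigr (fun=> 1)); last by move=> w _; rewrite big_ord0.
  by rewrite sumr_const card_ffun card_ord expn0 mul1r.
move=> [psi [hpsi h]].
have [c hc] := fin_all_exists (fun a => IH _ (hpsi a)).
exists (fun w => c (w ord0) [ffun j => w (lift ord0 j)]); split=> [w|z].
  by have [] := hc (w ord0).
rewrite h big_ffun_ord_recl; apply: eq_bigr => a _.
rewrite (hc a).2 mulr_sumr; apply: eq_bigr => w _.
rewrite big_ord_recl !ffunE unlift_none mulrA; congr (_ * _ * c _ _).
  by apply: eq_bigr => j _; rewrite ffunE liftK.
by apply/ffunP => j; rewrite !ffunE liftK.
Qed.

(** If the letters of v are independent with law p, then so are the letters
    read at distinct positions. *)
Lemma sampling_marginal (R : realFieldType) (A : finType) (D t : nat)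
    (p : A -> R) (i : {ffun 'I_D -> 'I_t}) (w : {ffun 'I_D -> A}) :
  \sum_a p a = 1 -> injective i ->
  \sum_(v : {ffun 'I_t -> A} | [ffun j => v (i j)] == w) \prod_s p (v s)
    = \prod_j p (w j).
Proof.
move=> p1 inj.
pose F s : pred A := fun a => [forall j, (i j == s) ==> (a == w j)].
rewrite (eq_bigl (fun v : {ffun 'I_t -> A} => v \in family F)); last first.
  move=> v; apply/eqP/familyP => [vw s|vw].
    apply/forallP => j; apply/implyP => /eqP <-.
    by rewrite -vw ffunE.
  apply/ffunP => j; rewrite ffunE; have /forallP/(_ j) := vw (i j).
  by rewrite eqxx /= => /eqP.
rewrite -(bigA_distr_big_dep F (fun _ a => p a)) /= (bigID (mem (codom i))) /=.
rewrite [X in _ * X]big1 ?mulr1; last first.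
  move=> s hs; rewrite -[RHS]p1; apply: eq_bigl => a; apply/forallP => j.
  by apply/implyP => /eqP e; rewrite -e codom_f in hs.
rewrite (eq_bigl (fun s => s \in (i @: 'I_D)%SET)); last first.
  by move=> s; apply/codomP/imsetP => [[j ->]|[j _ ->]]; exists j.
rewrite big_imset /=; last by move=> ? ? _ _; apply: inj.
apply: eq_bigr => j _; rewrite (big_pred1 (w j)) // => a.
apply/forallP/eqP => [/(_ j)|-> j']; first by rewrite eqxx /= => /eqP.
by apply/implyP => /eqP /inj ->.
Qed.

(** If P is the polynomial with coefficients c, this is the expansion of
    (sum_a p_a)^(t - D) P: its coefficient at the word v is the average of c
    over D letters of v drawn without replacement.  Both sides are multiplied by
    the number t ^_ D of such draws. *)
Lemma sampling_identity (R : realFieldType) (V : lmodType R) (A : finType)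
    (D t : nat) (p : A -> R) (c : {ffun 'I_D -> A} -> V) :
  \sum_a p a = 1 ->
  \sum_(v : {ffun 'I_t -> A}) (\prod_s p (v s)) *:
     \sum_(i : {ffun 'I_D -> 'I_t} | injectiveb i) c [ffun j => v (i j)]
  = (t ^_ D)%:R *: \sum_(w : {ffun 'I_D -> A}) (\prod_j p (w j)) *: c w.
Proof.
move=> p1.
under eq_bigr => v _ do rewrite scaler_sumr.
rewrite exchange_big /= (eq_bigr (fun=> \sum_(w : {ffun 'I_D -> A}) (\prod_j p (w j)) *: c w)).
  rewrite sumr_const -scaler_nat; congr (_%:R *: _).
  rewrite -[in RHS](card_ord t) -[in RHS](card_ord D) -card_inj_ffuns.
  by apply: eq_card => i; rewrite !inE.
move=> i /injectiveP inj.
rewrite (partition_big (fun v : {ffun 'I_t -> A} => [ffun j => v (i j)]) xpredT) //=.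
apply: eq_bigr => w _; rewrite -(sampling_marginal w p1 inj) scaler_suml.
by apply: eq_bigr => v /eqP ->.
Qed.

(** Divided by t^(D + 1): the positions of D draws among t are distinct with
    probability at least 1 - D^2 / t. *)
Lemma ffact_ge (R : realFieldType) (t D : nat) : (D <= t)%N ->
  t%:R * t%:R ^+ D - (D ^ 2)%:R * t%:R ^+ D <= t%:R * (t ^_ D)%:R :> R.
Proof.
elim: D => [|D IH] Dt; first by rewrite ffactn0 expr0 mul0r subr0.
have {IH} := IH (ltnW Dt); rewrite ffactnSr natrM natrB ?(ltnW Dt) // exprS.
rewrite !natrX -(natr1 D).
have D0 : 0 <= D%:R :> R by [].
have Dt' : D%:R <= t%:R :> R by rewrite ler_nat ltnW.
have q0 : 0 <= t%:R ^+ D :> R by rewrite exprn_ge0.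
move: (t%:R) (D%:R) (t%:R ^+ D) ((t ^_ D)%:R) D0 Dt' q0 => x b q g b0 bx q0 H.
have xb : 0 <= x - b by lra.
have := ler_wpM2r xb H.
have := mulr_ge0 (mulr_ge0 b0 b0) (mulr_ge0 b0 q0).
have x0 : 0 <= x by lra.
have := mulr_ge0 (mulr_ge0 x0 b0) q0; have := mulr_ge0 x0 q0.
nra.
Qed.

(** Polya theorem with its degree bound.  Drawing from v with replacement, the
    average of c is the value of the polynomial at the vector of frequencies of
    the letters in v, hence at least mu.  Draws that repeat a position are at
    most a fraction D^2 / t of all draws, and each of them counts for at most
    L. *)
Lemma sampling_ge0 (R : realFieldType) (A : finType) (D t : nat)
    (c : {ffun 'I_D -> A} -> R) (L mu : R) (v : {ffun 'I_t -> A}) :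
  (forall w, `|c w| <= L) ->
  (forall p : A -> R, (forall a, 0 <= p a) -> \sum_a p a = 1 ->
     mu <= \sum_(w : {ffun 'I_D -> A}) (\prod_j p (w j)) * c w) ->
  (0 < t)%N -> (D <= t)%N -> (D ^ 2)%:R * L <= t%:R * mu ->
  0 <= \sum_(i : {ffun 'I_D -> 'I_t} | injectiveb i) c [ffun j => v (i j)].
Proof.
move=> cL hmu t0 Dt hL.
have t0' : 0 < t%:R :> R by rewrite ltr0n.
have td0 : 0 < t%:R ^+ D :> R by rewrite exprn_gt0.
(* The frequency of the letter a in the urn. *)
pose p a : R := t%:R^-1 * \sum_s (v s == a)%:R.
have p0 a : 0 <= p a by rewrite mulr_ge0 ?invr_ge0 // sumr_ge0.
have p1 : \sum_a p a = 1.
  rewrite -mulr_sumr exchange_big /= (eq_bigr (fun=> 1)).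
    by rewrite sumr_const card_ord mulVf // gt_eqF.
  by move=> s _; rewrite (bigD1 (v s)) //= eqxx big1 ?addr0 // => a /negPf; rewrite eq_sym => ->.
have all_ : t%:R ^+ D * mu <= \sum_(i : {ffun 'I_D -> 'I_t}) c [ffun j => v (i j)].
  have -> : \sum_(i : {ffun 'I_D -> 'I_t}) c [ffun j => v (i j)] =
     t%:R ^+ D * \sum_(w : {ffun 'I_D -> A}) (\prod_j p (w j)) * c w; last by rewrite ler_pM2l ?hmu.
  rewrite (partition_big (fun i : {ffun 'I_D -> 'I_t} => [ffun j => v (i j)]) xpredT) //=.
  rewrite mulr_sumr; apply: eq_bigr => w _.
  rewrite (eq_bigr (fun=> 1 * c w)); last by move=> i /eqP ->; rewrite mul1r.
  rewrite -mulr_suml mulrA; congr (_ * _).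
  rewrite big_split /= prodr_const card_ord mulrA -exprMn mulfV ?gt_eqF // expr1n mul1r.
  rewrite bigA_distr_bigA /= big_mkcond /=; apply: eq_bigr => i _.
  have [/eqP e|/eqP ne] := ifPn.
    by rewrite big1 // => j _; rewrite -e ffunE eqxx.
  have [j hj] : exists j, v (i j) != w j.
    apply/existsP; rewrite -negb_forall; apply: contra_notN ne => /forallP h.
    by apply/ffunP => j; rewrite ffunE; apply/eqP.
  by rewrite (bigD1 j) //= (negPf hj) mul0r.
have L0 : 0 <= L.
  have [s _] : exists s : 'I_t, true by exists (Ordinal t0).
  by apply: le_trans (cL [ffun=> v s]).
have non : \sum_(i : {ffun 'I_D -> 'I_t} | ~~ injectiveb i) c [ffun j => v (i j)]
    <= L * (t%:R ^+ D - (t ^_ D)%:R).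
  apply: le_trans (_ : \sum_(i : {ffun 'I_D -> 'I_t} | ~~ injectiveb i) L <= _).
    by apply: ler_sum => i _; apply: le_trans (ler_norm _) (cL _).
  rewrite sumr_const -[leLHS]mulr_natr; apply: ler_wpM2l => //.
  have := cardC [pred i : {ffun 'I_D -> 'I_t} | injectiveb i].
  rewrite card_ffun !card_ord => e.
  have -> : (t ^_ D = #|[pred i : {ffun 'I_D -> 'I_t} | injectiveb i]|)%N.
    rewrite -[in LHS](card_ord t) -[in LHS](card_ord D) -card_inj_ffuns.
    by apply: eq_card => i; rewrite !inE.
  rewrite lerBrDr -natrX -natrD ler_nat -e addnC leq_add2l.
  by apply/eq_leq/eq_card => i; rewrite !inE.
move: all_; rewrite (bigID (fun i : {ffun 'I_D -> 'I_t} => injectiveb i)) /=.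
set S := \sum_(i : {ffun 'I_D -> 'I_t} | injectiveb i) _.
set N := \sum_(i : {ffun 'I_D -> 'I_t} | ~~ injectiveb i) _ in non *.
move=> all_.
rewrite -(pmulr_rge0 _ t0').
have := ffact_ge R Dt.
set g := (t ^_ D)%:R in non *; set q := t%:R ^+ D in td0 all_ non *.
set b := (D ^ 2)%:R in hL *; move: (t%:R) t0' hL => x x0 hL hg.
have H1 := ler_wpM2r L0 hg.
have H2 := ler_wpM2l (ltW td0) hL.
have H3 := ler_wpM2l (ltW x0) (le_trans all_ (lerD (lexx S) non)).
nra.
Qed.

(** * Quadratic forms and sums of squares of matrices *)

Lemma qformE (R : comNzRingType) l (C : 'M[R]_l) (v : 'cV[R]_l) :
  (v^T *m C *m v) 0 0 = \sum_a \sum_b v a 0 * C a b * v b 0.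
Proof.
rewrite mxE exchange_big /=; apply: eq_bigr => b _.
by rewrite mxE mulr_suml; apply: eq_bigr => a _; rewrite mxE.
Qed.

Lemma qform_delta (R : comNzRingType) l (C : 'M[R]_l) i :
  ((delta_mx i 0 : 'cV[R]_l)^T *m C *m (delta_mx i 0 : 'cV[R]_l)) 0 0 = C i i.
Proof. by rewrite -mulmxA trmx_delta -rowE mxE -colE mxE. Qed.

Lemma qform_shift (R : comNzRingType) l (C : 'M[R]_l) (v : 'cV[R]_l) i t :
  C^T = C ->
  let e : 'cV[R]_l := v + t *: delta_mx i 0 in
  (e^T *m C *m e) 0 0
    = (v^T *m C *m v) 0 0 + 2 * t * (C *m v) i 0 + t ^+ 2 * C i i.
Proof.
move=> symC e; rewrite /e.
have dl (w : 'cV[R]_l) : ((delta_mx i 0 : 'cV[R]_l)^T *m w) 0 0 = w i 0.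
  by rewrite trmx_delta -rowE !mxE.
have H1 : (v^T *m C *m (delta_mx i 0 : 'cV[R]_l)) 0 0 = (C *m v) i 0.
  have -> : v^T *m C *m (delta_mx i 0 : 'cV[R]_l) =
            ((delta_mx i 0 : 'cV[R]_l)^T *m (C *m v))^T.
    by rewrite !trmx_mul trmxK symC.
  by rewrite mxE dl.
have H2 : ((delta_mx i 0 : 'cV[R]_l)^T *m C *m (delta_mx i 0 : 'cV[R]_l)) 0 0 = C i i.
  exact: qform_delta.
have -> : (v + t *: delta_mx i 0)^T = v^T + t *: (delta_mx i 0)^T.
  by rewrite linearD linearZ.
rewrite !(mulmxDl, mulmxDr) -!scalemxAl -!scalemxAr.
have H3 := dl (C *m v); rewrite mulmxA in H3.
rewrite -H2 -H3; move: H1; rewrite -H3.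
move: (v^T *m C *m v) (v^T *m C *m _) (_ *m C *m v) (_ *m C *m delta_mx i 0) => a b c d.
by rewrite !mxE => ->; ring.
Qed.

(** Gaussian elimination on the support S of D.  If a pivot D i i is positive,
    subtracting the square of row i divided by sqrt (D i i) keeps the form
    nonnegative and clears row and column i; if it is zero, row i is already
    zero. *)
Lemma psd_sum_squares (R : realType) l (C : 'M[R]_l) :
  C^T = C -> psdmx C -> exists Us : seq 'M[R]_l, C = \sum_(U <- Us) U^T *m U.
Proof.
suff H k (S : {set 'I_l}) (D : 'M[R]_l) : (#|S| <= k)%N ->
    (forall a b, D a b != 0 -> a \in S) -> D^T = D -> psdmx D ->
    exists Us : seq 'M[R]_l, D = \sum_(U <- Us) U^T *m U.
  by move=> symC psdC; apply: (H _ (finset.setT : {set 'I_l}) C (leqnn _)) => // a b _; rewrite inE.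
elim: k S D => [|k IH] S D hS suppD symD psdD.
  exists [::]; rewrite big_nil; apply/matrixP => a b; rewrite mxE.
  apply/eqP; apply: contraTT hS => /suppD aS; rewrite -ltnNge.
  by apply/card_gt0P; exists a.
have [S0|[i iS]] := set_0Vmem S; first by apply: (IH S) => //; rewrite S0 cards0.
have symE a b : D a b = D b a by rewrite -{1}symD mxE.
have shift v t := qform_shift v i t symD.
have Dii : 0 <= D i i.
  by have := psdD (delta_mx i 0); rewrite qform_delta.
have cS : (#|S :\ i| <= k)%N by move: hS; rewrite (cardsD1 i) iS.
have [D0|Dn0] := eqVneq (D i i) 0.
  have row0 b : D i b = 0.
    apply/eqP; apply: contraT => Dib.
    (* At this vector the form takes the value -1. *)
    have := psdD (delta_mx b 0 + (- (D b b + 1) / (2 * D i b)) *: delta_mx i 0).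
    rewrite shift D0 mulr0 addr0 qform_delta -colE mxE.
    have -> : 2 * (- (D b b + 1) / (2 * D i b)) * D i b = - (D b b + 1) by field.
    by lra.
  apply: (IH (S :\ i)) => // a b Dab; rewrite !inE (suppD _ _ Dab) andbT.
  by apply: contraNneq Dab => ->; rewrite row0.
have Dgt : 0 < D i i by rewrite lt_neqAle eq_sym Dn0.
pose U : 'M[R]_l := \matrix_(a, b) (if a == i then D i b / Num.sqrt (D i i) else 0).
have UE a b : (U^T *m U) a b = D i a * D i b / D i i.
  rewrite mxE (bigD1 i) //= big1 ?addr0; last first.
    by move=> j /negPf ji; rewrite !mxE ji mulr0.
  by rewrite !mxE eqxx mulrACA -invfM -expr2 sqr_sqrtr.
have [|||Us hUs] := IH (S :\ i) (D - U^T *m U) cS.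
- move=> a b; rewrite [_ a b]mxE [X in _ + X]mxE UE => h; rewrite !inE.
  apply/andP; split; first by apply: contraNneq h => ->; rewrite mulrAC mulfV // mul1r subrr.
  apply: contraNT h => aS.
  have -> : D a b = 0 by apply/eqP; apply: contraNT aS => /suppD.
  have -> : D i a = 0 by rewrite symE; apply/eqP; apply: contraNT aS => /suppD.
  by rewrite !mul0r subrr.
- by rewrite linearB /= trmx_mul trmxK symD.
- (* The reduced form at v is the form of D at v moved along the pivot so
     that the square subtracted vanishes. *)
  move=> v; have := psdD (v + (- ((D *m v) i 0 / D i i)) *: delta_mx i 0).
  rewrite shift => H; rewrite mulmxBr mulmxBl [X in 0 <= X]mxE [X in _ + X]mxE; move: H.
  have -> : (v^T *m (U^T *m U) *m v) 0 0 = (D *m v) i 0 ^+ 2 / D i i.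
    rewrite qformE (eq_bigr (fun a => (D i a * v a 0) * ((D *m v) i 0) / D i i)).
      by rewrite -!mulr_suml expr2; congr (_ * _ / _); rewrite mxE.
    move=> a _; rewrite [in RHS]mxE mulr_sumr mulr_suml; apply: eq_bigr => b _.
    by rewrite UE; ring.
  move: ((D *m v) i 0) => w; rewrite (_ : _ + _ + _ = (v^T *m D *m v) 0 0 - w ^+ 2 / D i i) //.
  by field.
- by exists (U :: Us); rewrite big_cons -hUs addrC subrK.
Qed.

Section QuadraticForm.
Variables (R : realType) (l : nat).
Implicit Types (M : 'M[R]_l) (u : 'cV[R]_l).

Definition qform M u : R := (u^T *m M *m u) 0 0.
Definition sqnorm u : R := \sum_a u a 0 ^+ 2.

Lemma sqnorm_ge0 u : 0 <= sqnorm u.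
Proof. by apply: sumr_ge0 => a _; rewrite sqr_ge0. Qed.

Lemma qformD M M' u : qform (M + M') u = qform M u + qform M' u.
Proof. by rewrite /qform mulmxDr mulmxDl mxE. Qed.

Lemma qformZ s M u : qform (s *: M) u = s * qform M u.
Proof. by rewrite /qform -scalemxAr -scalemxAl mxE. Qed.

Lemma qformT M u : qform M^T u = qform M u.
Proof.
rewrite /qform; have -> : u^T *m M^T *m u = (u^T *m M *m u)^T.
  by rewrite !trmx_mul trmxK mulmxA.
by rewrite mxE.
Qed.

Lemma qform_sum (I : Type) (r : seq I) (P : pred I) (F : I -> 'M[R]_l) u :
  qform (\sum_(i <- r | P i) F i) u = \sum_(i <- r | P i) qform (F i) u.
Proof. by rewrite /qform mulmx_sumr mulmx_suml summxE. Qed.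

Lemma qform_scalar s u : qform s%:M u = s * sqnorm u.
Proof.
rewrite -scalemx1 qformZ /qform mulmx1 mxE; congr (_ * _).
by apply: eq_bigr => a _; rewrite mxE expr2.
Qed.

Lemma qform_bound M (L : R) u : 0 <= L -> (forall a b, `|M a b| <= L) ->
  `|qform M u| <= L * l%:R * sqnorm u.
Proof.
move=> L0 h; rewrite /qform qformE; apply: le_trans (ler_norm_sum _ _ _) _.
apply: (@le_trans _ _ (\sum_a \sum_b L * ((u a 0 ^+ 2 + u b 0 ^+ 2) / 2))).
  apply: ler_sum => a _; apply: le_trans (ler_norm_sum _ _ _) _.
  apply: ler_sum => b _; rewrite mulrAC normrM mulrC.
  apply: ler_pM => //; rewrite normrM.
  rewrite -[u a 0 ^+ 2]real_normK ?num_real // -[u b 0 ^+ 2]real_normK ?num_real //.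
  have := sqr_ge0 (`|u a 0| - `|u b 0|).
  by rewrite sqrrB ler_pdivlMr // => *; lra.
rewrite le_eqVlt; apply/orP; left; apply/eqP.
have E a : \sum_b L * ((u a 0 ^+ 2 + u b 0 ^+ 2) / 2)
    = L / 2 * (l%:R * u a 0 ^+ 2 + sqnorm u).
  have -> : l%:R * u a 0 ^+ 2 = \sum_(b < l) u a 0 ^+ 2.
    by rewrite sumr_const card_ord mulr_natl.
  by rewrite -big_split mulr_sumr; apply: eq_bigr => b _ /=; field.
under eq_bigr => a _ do rewrite E.
rewrite -mulr_sumr big_split /= -mulr_sumr sumr_const card_ord -[in LHS]mulr_natl.
by rewrite -/(sqnorm u); field.
Qed.

End QuadraticForm.

(** * Certificates on the unit sphere *)

Section Degree.
Variables (R : realType) (N : nat).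
Implicit Types p q : {mpoly R[N]}.

Definition degle (k : nat) p := (msize p <= k.+1)%N.

Lemma degleP k p : degle k p = (mpdeg p <= k)%N.
Proof. by rewrite /degle /mpdeg; case: (msize p). Qed.

Lemma degle_le k k' p : (k <= k')%N -> degle k p -> degle k' p.
Proof. by rewrite /degle => kk' h; apply: leq_trans h _. Qed.

Lemma degle0 k : degle k 0.
Proof. by rewrite /degle msize0. Qed.

Lemma degleC k c : degle k c%:MP.
Proof. by rewrite /degle msizeC; case: (c != 0). Qed.

Lemma degle1 k : degle k 1.
Proof. exact: degleC. Qed.

Lemma degleX k i : (0 < k)%N -> degle k 'X_i.
Proof. by rewrite /degle msizeX mdeg1. Qed.

Lemma degleXm k a : (mdeg a <= k)%N -> degle k 'X_[a].
Proof. by rewrite /degle msizeX. Qed.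

Lemma degleD k p q : degle k p -> degle k q -> degle k (p + q).
Proof.
by move=> hp hq; apply: leq_trans (msizeD_le _ _) _; rewrite geq_max; apply/andP.
Qed.

Lemma degleN k p : degle k p -> degle k (- p).
Proof. by rewrite /degle msizeN. Qed.

Lemma degleZ k c p : degle k p -> degle k (c *: p).
Proof. by apply: leq_trans; apply: msizeZ_le. Qed.

Lemma degle_sum k (I : Type) (r : seq I) (P : pred I) (F : I -> {mpoly R[N]}) :
  (forall i, P i -> degle k (F i)) -> degle k (\sum_(i <- r | P i) F i).
Proof.
move=> h; elim/big_rec: _ => [|i x Pi]; first exact: degle0.
by apply: degleD; apply: h.
Qed.

Lemma degleM k k' p q : degle k p -> degle k' q -> degle (k + k') (p * q).
Proof.
have [->|p0] := eqVneq p 0; first by rewrite mul0r => _ _; apply: degle0.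
have [->|q0] := eqVneq q 0; first by rewrite mulr0 => _ _; apply: degle0.
rewrite /degle msizeM //; move: p0 q0; rewrite -!msize_poly_eq0.
case: (msize p) (msize q) => [|a] [|b] //= _ _ ha hb.
by rewrite !addnS /= ltnS; apply: leq_add.
Qed.
End Degree.

Section Sphere.
Variables (R : realType) (N : nat).
Implicit Types (p q : {mpoly R[N]}) (z : 'rV[R]_N) (s : 'rV[R]_N -> R).

Definition unit_sphere z := \sum_(i < N) z 0 i ^+ 2 = 1.

(** Equality is required on the sphere only, so that no multiple of 1 - |z|^2
    has to be recorded. *)
Definition sphere_sos (k : nat) s := exists qs : seq {mpoly R[N]},
  all (degle k) qs /\ forall z, unit_sphere z -> s z = \sum_(q <- qs) q.@[z 0] ^+ 2.

Lemma eq_sphere_sos k s s' : (forall z, unit_sphere z -> s z = s' z) ->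
  sphere_sos k s -> sphere_sos k s'.
Proof. by move=> e [qs [h1 h2]]; exists qs; split=> // z hz; rewrite -e // h2. Qed.

Lemma sphere_sos_le k k' s : (k <= k')%N -> sphere_sos k s -> sphere_sos k' s.
Proof.
move=> kk' [qs [h1 h2]]; exists qs; split=> //.
by apply: sub_all h1 => q; apply: degle_le.
Qed.

Lemma sphere_sos_sqr k q : degle k q -> sphere_sos k (fun z => q.@[z 0] ^+ 2).
Proof. by exists [:: q]; split=> /= [|z _]; rewrite ?big_seq1 ?andbT. Qed.

Lemma sphere_sosC k (c : R) : 0 <= c -> sphere_sos k (fun=> c).
Proof.
move=> c0; apply: eq_sphere_sos _ (sphere_sos_sqr (degleC N k (Num.sqrt c))) => z _.
by rewrite mevalC sqr_sqrtr.
Qed.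

Lemma sphere_sosD k s s' : sphere_sos k s -> sphere_sos k s' ->
  sphere_sos k (fun z => s z + s' z).
Proof.
move=> [qs [h1 h2]] [qs' [h1' h2']]; exists (qs ++ qs').
by rewrite all_cat h1 h1'; split=> // z hz; rewrite big_cat h2 ?h2'.
Qed.

Lemma sphere_sosM k k' s s' : sphere_sos k s -> sphere_sos k' s' ->
  sphere_sos (k + k') (fun z => s z * s' z).
Proof.
move=> [qs [h1 h2]] [qs' [h1' h2']]; exists [seq q * q' | q <- qs, q' <- qs'].
split=> [|z hz].
  apply/allP => _ /allpairsP[[q q'] /= [hq hq' ->]].
  by apply: degleM; [apply: (allP h1)|apply: (allP h1')].
rewrite h2 // h2' // big_allpairs_dep mulr_suml; apply: eq_bigr => q _.
by rewrite mulr_sumr; apply: eq_bigr => q' _; rewrite mevalM exprMn.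
Qed.

Lemma sphere_sos_sum k (I : Type) (r : seq I) (P : pred I) (F : I -> 'rV[R]_N -> R) :
  (forall i, P i -> sphere_sos k (F i)) ->
  sphere_sos k (fun z => \sum_(i <- r | P i) F i z).
Proof.
move=> h; elim: r => [|i r IH].
  by apply: eq_sphere_sos _ (sphere_sosC k (lexx 0)) => z _; rewrite big_nil.
have [Pi|nPi] := boolP (P i).
  apply: eq_sphere_sos _ (sphere_sosD (h i Pi) IH) => z _.
  by rewrite big_cons Pi.
by apply: eq_sphere_sos _ IH => z _; rewrite big_cons (negPf nPi).
Qed.

Lemma sphere_sos_prod k (F : nat -> 'rV[R]_N -> R) t :
  (forall i, sphere_sos k (F i)) ->
  sphere_sos (t * k) (fun z => \prod_(i < t) F i z).
Proof.
move=> h; elim: t => [|t IH].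
  by apply: eq_sphere_sos _ (sphere_sosC 0 ler01) => z _; rewrite big_ord0.
rewrite mulSn addnC; apply: eq_sphere_sos _ (sphere_sosM IH (h t)) => z _.
by rewrite big_ord_recr.
Qed.

End Sphere.

Section Cone.
Variables (R : realType) (N m : nat) (G : 'M[{mpoly R[N]}]_m) (c : nat).

(** The truncated quadratic module of G as a cone of functions on the sphere.
    It is used for forms G of degree 2 c, so that no term exceeds the degree
    2 k. *)
Definition sphere_qm (l k : nat) (A : 'rV[R]_N -> 'M[R]_l) :=
  exists (Qs : seq 'M[{mpoly R[N]}]_l) (Ps : seq 'M[{mpoly R[N]}]_(m, l)),
  [/\ forall Q, Q \in Qs -> forall a b, degle k (Q a b),
      forall P, P \in Ps -> (c <= k)%N /\ forall a b, degle (k - c) (P a b)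
    & forall z, unit_sphere z -> A z =
        \sum_(Q <- Qs) (mxeval Q z)^T *m mxeval Q z +
        \sum_(P <- Ps) (mxeval P z)^T *m mxeval G z *m mxeval P z].

Lemma eq_sphere_qm l k (A B : 'rV[R]_N -> 'M[R]_l) :
  (forall z, unit_sphere z -> A z = B z) -> sphere_qm k A -> sphere_qm k B.
Proof.
move=> e [Qs [Ps [h1 h2 h3]]]; exists Qs, Ps; split=> // z hz.
by rewrite -e // h3.
Qed.

Lemma sphere_qm_le l k k' (A : 'rV[R]_N -> 'M[R]_l) :
  (k <= k')%N -> sphere_qm k A -> sphere_qm k' A.
Proof.
move=> kk' [Qs [Ps [h1 h2 h3]]]; exists Qs, Ps; split=> //.
  by move=> Q hQ a b; apply: degle_le (h1 _ hQ a b).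
move=> P hP; have [ck hP'] := h2 P hP; split; first exact: leq_trans ck kk'.
by move=> a b; apply: degle_le (hP' a b); apply: leq_sub2r.
Qed.

Lemma sphere_qmD l k (A B : 'rV[R]_N -> 'M[R]_l) :
  sphere_qm k A -> sphere_qm k B -> sphere_qm k (fun z => A z + B z).
Proof.
move=> [Qs [Ps [h1 h2 h3]]] [Qs' [Ps' [h1' h2' h3']]].
exists (Qs ++ Qs'), (Ps ++ Ps'); split.
- by move=> Q; rewrite mem_cat => /orP[/h1|/h1'].
- by move=> Q; rewrite mem_cat => /orP[/h2|/h2'].
- by move=> z hz; rewrite !big_cat /= h3 // h3' // addrACA.
Qed.

Lemma sphere_qm0 l k : sphere_qm k (fun=> 0 : 'M[R]_l).
Proof. by exists [::], [::]; split=> // z _; rewrite !big_nil addr0. Qed.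

Lemma sphere_qm_sum l k (I : Type) (r : seq I) (F : I -> 'rV[R]_N -> 'M[R]_l) :
  (forall i, sphere_qm k (F i)) -> sphere_qm k (fun z => \sum_(i <- r) F i z).
Proof.
move=> h; elim: r => [|i r IH].
  by apply: eq_sphere_qm _ (sphere_qm0 l k) => z _; rewrite big_nil.
by apply: eq_sphere_qm _ (sphere_qmD (h i) IH) => z _; rewrite big_cons.
Qed.

Lemma sphere_qm_sqr l k (Q : 'M[{mpoly R[N]}]_l) :
  (forall a b, degle k (Q a b)) ->
  sphere_qm k (fun z => (mxeval Q z)^T *m mxeval Q z).
Proof.
move=> h; exists [:: Q], [::]; split=> //.
  by move=> Q'; rewrite inE => /eqP ->.
by move=> z _; rewrite big_seq1 big_nil addr0.
Qed.

Lemma sphere_qm_gen l k (P : 'M[{mpoly R[N]}]_(m, l)) :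
  (forall a b, degle k (P a b)) ->
  sphere_qm (k + c) (fun z => (mxeval P z)^T *m mxeval G z *m mxeval P z).
Proof.
move=> h; exists [::], [:: P]; split=> //.
  by move=> P'; rewrite inE => /eqP ->; rewrite leq_addl addnK.
by move=> z _; rewrite big_seq1 big_nil add0r.
Qed.

Lemma mxevalZ p q (f : {mpoly R[N]}) (A : 'M[{mpoly R[N]}]_(p, q)) z :
  mxeval (f *: A) z = f.@[z 0] *: mxeval A z.
Proof. by apply/matrixP => a b; rewrite !mxE mevalM. Qed.

Lemma mxevalT p q (A : 'M[{mpoly R[N]}]_(p, q)) z : mxeval A^T z = (mxeval A z)^T.
Proof. by apply/matrixP => a b; rewrite !mxE. Qed.

Lemma mxevalD p q (A B : 'M[{mpoly R[N]}]_(p, q)) z :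
  mxeval (A + B) z = mxeval A z + mxeval B z.
Proof. by apply/matrixP => a b; rewrite !mxE mevalD. Qed.

Lemma mxeval_sum p q (I : Type) (r : seq I) (F : I -> 'M[{mpoly R[N]}]_(p, q)) z :
  mxeval (\sum_(i <- r) F i) z = \sum_(i <- r) mxeval (F i) z.
Proof.
elim: r => [|i r IH]; last by rewrite !big_cons mxevalD IH.
by rewrite !big_nil; apply/matrixP => a b; rewrite !mxE meval0.
Qed.

Lemma mxevalM p q r (A : 'M[{mpoly R[N]}]_(p, q)) (B : 'M[{mpoly R[N]}]_(q, r)) z :
  mxeval (A *m B) z = mxeval A z *m mxeval B z.
Proof.
apply/matrixP => a b; rewrite !mxE rmorph_sum; apply: eq_bigr => i _.
by rewrite !mxE; apply: mevalM.
Qed.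

Lemma mxevalC p q (A : 'M[R]_(p, q)) z :
  mxeval (map_mx (mpolyC N (R := R)) A) z = A.
Proof. by apply/matrixP => a b; rewrite !mxE mevalC. Qed.

Lemma sphere_qm_sosM l k k' s (A : 'rV[R]_N -> 'M[R]_l) :
  sphere_sos k s -> sphere_qm k' A -> sphere_qm (k + k') (fun z => s z *: A z).
Proof.
move=> [qs [hq hs]] [Qs [Ps [h1 h2 h3]]].
exists [seq q *: Q | q <- qs, Q <- Qs], [seq q *: P | q <- qs, P <- Ps]; split.
- move=> _ /allpairsP[[q Q] /= [/(allP hq) hq' /h1 hQ ->]] a b.
  by rewrite mxE; apply: degleM.
- move=> _ /allpairsP[[q P] /= [/(allP hq) hq' /h2 [ck hP] ->]].
  split; first by apply: leq_trans ck _; apply: leq_addl.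
  by move=> a b; rewrite mxE -addnBA //; apply: degleM.
- move=> z hz; rewrite hs // h3 // scalerDr !big_allpairs_dep /= !scaler_suml.
  congr (_ + _); apply: eq_bigr => q _; rewrite scaler_sumr; apply: eq_bigr => B _;
    by rewrite mxevalZ [(_ *: _)^T]linearZ /= -!scalemxAl -!scalemxAr scalerA -expr2.
Qed.

Lemma sphere_qm_psd l k (C : 'M[R]_l) : C^T = C -> psdmx C -> sphere_qm k (fun=> C).
Proof.
move=> symC psdC; have [Us ->] := psd_sum_squares symC psdC.
apply: sphere_qm_sum => U.
apply: eq_sphere_qm _ (sphere_qm_sqr (Q := map_mx (mpolyC N (R := R)) U) _).
  by move=> z _; rewrite mxevalC.
by move=> a b; rewrite mxE degleC.
Qed.

End Cone.

(** * Polynomials are determined by their values *)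

Section EvalInj.
Variable R : realType.

(** Seen as a polynomial in the first variable, the sum has infinitely many
    roots; hence each of its coefficients is a function of the other variables
    that vanishes identically. *)
Lemma box_coef_eq0 (n B : nat) (c : {ffun 'I_n -> 'I_B} -> R) :
  (forall v : 'I_n -> R,
     \sum_(f : {ffun 'I_n -> 'I_B}) (\prod_i v i ^+ f i) * c f = 0) ->
  forall f, c f = 0.
Proof.
elim: n c => [|n IH] c h f.
  rewrite -[RHS](h (fun=> 0)) (bigD1 f) //= big_ord0 mul1r big1 ?addr0 // => g.
  by move=> /eqP []; apply/ffunP => -[].
pose cons (a : 'I_B) (w : {ffun 'I_n -> 'I_B}) : {ffun 'I_n.+1 -> 'I_B} :=
  [ffun i => if unlift ord0 i is Some j then w j else a].
have fE : f = cons (f ord0) [ffun j => f (lift ord0 j)].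
  apply/ffunP => i; rewrite ffunE.
  by case: unliftP => [j ->|->]; rewrite ?ffunE.
rewrite fE; move: (f ord0) [ffun j => f (lift ord0 j)] => a w {f fE}.
apply: (IH (fun w => c (cons a w))) => v.
pose q : {poly R} := \poly_(k < B)
  (if insub k is Some b then
     \sum_(w : {ffun 'I_n -> 'I_B}) (\prod_i v i ^+ w i) * c (cons b w)
   else 0).
have qE (b : 'I_B) : q`_b = \sum_(w : {ffun 'I_n -> 'I_B}) (\prod_i v i ^+ w i) * c (cons b w).
  by rewrite coef_poly ltn_ord valK.
rewrite -qE; suff -> : q = 0 by rewrite coef0.
apply/eqP; apply: contraT => q0.
have roots_q x : root q x.
  rewrite /root horner_poly; apply/eqP.
  rewrite -[RHS](h (fun i => if unlift ord0 i is Some j then v j else x)).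
  rewrite big_ffun_ord_recl; apply: eq_bigr => b _.
  rewrite valK mulr_suml; apply: eq_bigr => w' _.
  rewrite big_ord_recl unlift_none /= ffunE unlift_none.
  rewrite [x ^+ b * _]mulrC mulrAC; congr (_ * _ * _).
  by apply: eq_bigr => i _; rewrite liftK ffunE liftK.
have := max_poly_roots q0 (rs := [seq k%:R | k <- iota 0 (size q)]).
rewrite size_map size_iota ltnn => -> //.
  by apply/allP => x _; apply: roots_q.
by rewrite map_inj_uniq ?iota_uniq //; apply: mulrIn; rewrite oner_eq0.
Qed.

(** Certificates on the sphere are identities between values; this makes them
    identities between polynomials. *)
Lemma meval_inj n (p q : {mpoly R[n]}) :
  (forall x : 'rV[R]_n, p.@[x 0] = q.@[x 0]) -> p = q.
Proof.
move=> h; apply/subr0_eq; set r := p - q.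
have {}h (v : 'I_n -> R) : r.@[v] = 0.
  have := h (\row_i v i); rewrite mevalB => e.
  have E s : s.@[(\row_i v i) 0] = s.@[v] by apply: meval_eq => i; rewrite mxE.
  by rewrite !E in e; rewrite e subrr.
pose B := (msize r).+1.
pose mon (f : {ffun 'I_n -> 'I_B}) : 'X_{1..n} := [multinom (f i : nat) | i < n].
have monI : injective mon.
  move=> f g /mnmP e; apply/ffunP => i; apply: val_inj.
  by have := e i; rewrite !mnmE.
have monK m : m \in msupp r -> mon [ffun i => inord (m i)] = m.
  move=> mr; apply/mnmP => i; rewrite mnmE ffunE inordK // ltnS ltnW //.
  apply: leq_ltn_trans (msize_mdeg_lt mr).
  by rewrite mdegE (bigD1 i) //= leq_addr.
have c0 : forall f, r@_(mon f) = 0.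
  apply: box_coef_eq0 => v; rewrite -[RHS](h v) mevalE.
  have perm : perm_eq (msupp r) [seq mon f | f <- enum {ffun 'I_n -> 'I_B} & mon f \in msupp r].
    apply: uniq_perm; first exact: msupp_uniq.
      by rewrite map_inj_uniq // filter_uniq // enum_uniq.
    move=> m; apply/idP/mapP => [mr|[f + ->]]; last by rewrite mem_filter => /andP[].
    exists [ffun i => inord (m i)]; last by rewrite monK.
    by rewrite mem_filter monK // mem_enum mr.
  rewrite (perm_big _ perm) big_map big_filter /= [RHS]big_mkcond /= big_enum /=.
  apply: eq_bigr => f _; case: ifPn => [_|/memN_msupp_eq0 ->]; last by rewrite mulr0.
  by rewrite mulrC; congr (_ * _); apply: eq_bigr => i _; rewrite mnmE.
apply/mpolyP => m; rewrite mcoeff0.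
have [mr|/memN_msupp_eq0 //] := boolP (m \in msupp r).
by rewrite -(monK m).
Qed.

End EvalInj.

(** * Homogeneous coordinates *)

Section DegreePower.
Variables (R : realType) (N : nat).

Lemma degle_exp k r (p : {mpoly R[N]}) : degle k p -> degle (r * k) (p ^+ r).
Proof.
move=> h; elim: r => [|r IH]; first by rewrite expr0 degle1.
by rewrite exprS mulSn; apply: degleM.
Qed.

Lemma degle_monomial (I : finType) (f : I -> 'I_N) (a : I -> nat) :
  degle (\sum_i a i) (\prod_i 'X_(f i) ^+ a i : {mpoly R[N]}).
Proof.
elim/big_rec2: _ => [|i q k _ h]; first exact: degle1.
by apply: degleM => //; have := degle_exp (a i) (degleX R (f i) (ltnSn 0)); rewrite muln1.
Qed.
End DegreePower.

Section Dehomogenization.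
Variables (R : realType) (n : nat).
Implicit Types (q : {mpoly R[n.+1]}) (x : 'rV[R]_n) (s : R).

(** For s^2 = 1 + |x|^2, the points with parameters s and - s are those where
    the line through the origin and (1, x) meets the unit sphere. *)
Definition hpoint s x : 'rV[R]_n.+1 :=
  \row_i (s^-1 * (if unlift ord0 i is Some j then x 0 j else 1)).

Definition onepsq : {mpoly R[n]} := 1 + \sum_(i < n) 'X_i ^+ 2.

Lemma onepsqE x : onepsq.@[x 0] = 1 + \sum_(i < n) x 0 i ^+ 2.
Proof.
rewrite mevalD meval1 rmorph_sum; congr (_ + _); apply: eq_bigr => i _.
by rewrite rmorphXn /= mevalXU.
Qed.

Lemma degle_onepsq : degle 2 onepsq.
Proof.
apply: degleD; first exact: degle1.
by apply: degle_sum => i _; have := degle_exp 2 (degleX R i (ltnSn 0)).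
Qed.

Lemma onepsq_gt0 x : 0 < onepsq.@[x 0].
Proof. by rewrite onepsqE ltr_wpDr // sumr_ge0 // => i _; rewrite sqr_ge0. Qed.

Lemma hpoint_sphere s x : s ^+ 2 = onepsq.@[x 0] -> unit_sphere (hpoint s x).
Proof.
move=> hs; have s0 : s != 0.
  by apply: contraTneq (onepsq_gt0 x) => s0; rewrite -hs s0 expr0n ltxx.
rewrite /unit_sphere big_ord_recl mxE unlift_none mulr1.
under eq_bigr => i _ do rewrite mxE liftK exprMn.
rewrite -mulr_sumr -[X in X + _]mulr1 -mulrDr -onepsqE -hs.
by rewrite -exprMn mulVf ?expr1n.
Qed.

Lemma mdeg_ord_recl (a : 'X_{1..n.+1}) :
  mdeg a = (a ord0 + \sum_(i < n) a (lift ord0 i))%N.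
Proof. by rewrite mdegE big_ord_recl. Qed.

Lemma hpoint_monomial s x (a : 'X_{1..n.+1}) :
  \prod_i hpoint s x 0 i ^+ a i = s^-1 ^+ mdeg a * \prod_(i < n) x 0 i ^+ a (lift ord0 i).
Proof.
rewrite big_ord_recl mxE unlift_none mulr1.
under eq_bigr => i _ do rewrite mxE liftK exprMn.
by rewrite big_split /= -expr_sum mulrA -exprD -mdeg_ord_recl.
Qed.

(** The monomial of exponent a at (1, x) / s, multiplied by s^k, is a polynomial
    in x times s^(k - mdeg a).  Here s^2 is replaced by 1 + |x|^2 as often as
    possible, and a remaining factor s is dropped. *)
Definition dehom_term (k : nat) (a : 'X_{1..n.+1}) : {mpoly R[n]} :=
  onepsq ^+ (k - mdeg a)./2 * \prod_(i < n) 'X_i ^+ a (lift ord0 i).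

(** The terms of s^k q((1, x) / s) without (b = false) and with (b = true) a
    remaining factor s.  They do not depend on the sign of s. *)
Definition dehom (k : nat) (b : bool) q : {mpoly R[n]} :=
  \sum_(a <- msupp q | odd (k - mdeg a) == b) q@_a *: dehom_term k a.

Lemma degle_dehom_term k (a : 'X_{1..n.+1}) : (mdeg a <= k)%N ->
  degle (k - odd (k - mdeg a)) (dehom_term k a).
Proof.
move=> ak; apply: (@degle_le _ _ ((k - mdeg a)./2 * 2 + \sum_(i < n) a (lift ord0 i))).
  have := mdeg_ord_recl a; have := odd_double_half (k - mdeg a); rewrite muln2.
  move: (\sum_(i < n) _)%N (odd _ : nat) (_./2).*2 => S o h; lia.
by apply: degleM; [apply: degle_exp degle_onepsq|apply: degle_monomial].
Qed.

Lemma degle_dehom k b q : degle k q -> degle k (dehom k b q).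
Proof.
move=> hq; rewrite /dehom big_seq_cond; apply: degle_sum => a /andP[aq _].
apply/degleZ/degle_le/degle_dehom_term; first exact: leq_subr.
by rewrite -ltnS; apply: leq_trans (msize_mdeg_lt aq) hq.
Qed.

(** The odd part has degree at most k - 1, which leaves room for one more
    variable. *)
Lemma degle_Xdehom k q i : degle k q -> degle k ('X_i * dehom k true q).
Proof.
move=> hq; rewrite /dehom big_seq_cond mulr_sumr; apply: degle_sum => a /andP[aq /eqP o].
have ak : (mdeg a <= k)%N by rewrite -ltnS; apply: leq_trans (msize_mdeg_lt aq) hq.
rewrite -scalerAr; apply: degleZ.
have := degleM (degleX R i (ltnSn 0)) (degle_dehom_term ak); rewrite o add1n subn1.
rewrite prednK //; case: k o {hq ak} => //.
Qed.

Lemma dehomE k q s x : degle k q -> s ^+ 2 = onepsq.@[x 0] ->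
  s ^+ k * q.@[hpoint s x 0] = (dehom k false q).@[x 0] + s * (dehom k true q).@[x 0].
Proof.
move=> hq hs; have s0 : s != 0.
  by apply: contraTneq (onepsq_gt0 x) => s0; rewrite -hs s0 expr0n ltxx.
rewrite mevalE mulr_sumr (bigID (fun a => odd (k - mdeg a) == false)) /=.
have mon a : a \in msupp q -> s ^+ k * (q@_a * \prod_i hpoint s x 0 i ^+ a i) =
    s ^+ odd (k - mdeg a) * (q@_a *: dehom_term k a).@[x 0].
  move=> aq; have ak : (mdeg a <= k)%N.
    by rewrite -ltnS; apply: leq_trans (msize_mdeg_lt aq) hq.
  rewrite hpoint_monomial mevalZ mevalM rmorphXn /= -hs rmorph_prod /=.
  under [in RHS]eq_bigr => i _ do rewrite rmorphXn /= mevalXU.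
  rewrite -exprM mulnC muln2.
  rewrite mulrCA [in RHS]mulrCA; congr (_ * _); rewrite !mulrA; congr (_ * _).
  by rewrite -exprD odd_double_half -{1}(subnK ak) exprD -mulrA exprVn mulfV ?mulr1 ?expf_neq0.
congr (_ + _).
  rewrite rmorph_sum /= [LHS]big_seq_cond [RHS]big_seq_cond.
  by apply: eq_bigr => a /andP[aq /eqP o]; rewrite mon // o mul1r.
rewrite rmorph_sum /= mulr_sumr [LHS]big_seq_cond [RHS]big_seq_cond.
apply: eq_big => [a|a /andP[aq o]]; first by case: (odd _).
by rewrite mon //; move: o; case: (odd _).
Qed.

Lemma homogenizeE d (p : {mpoly R[n]}) s x : degle d p -> s != 0 ->
  s ^+ d * (homogenize d p).@[hpoint s x 0] = p.@[x 0].
Proof.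
move=> hp s0; rewrite rmorph_sum /= [in RHS]mevalE mulr_sumr.
rewrite [LHS]big_seq_cond [RHS]big_seq_cond; apply: eq_bigr => a /andP[aq _].
have ad : (mdeg a <= d)%N by rewrite -ltnS; apply: leq_trans (msize_mdeg_lt aq) hp.
rewrite mevalZ mulrCA; congr (_ * _); rewrite mevalM rmorphXn /= mevalXU rmorph_prod /=.
rewrite mxE unlift_none mulr1.
under eq_bigr => i _ do rewrite rmorphXn /= mevalXU mxE liftK exprMn.
rewrite big_split /= -expr_sum -mdegE mulrAC -exprD subnKC //.
by rewrite mulrA exprVn mulfV ?mul1r ?expf_neq0.
Qed.

(** Since d exceeds the degree, every term keeps a factor x_0. *)
Lemma homogenize_infty d (p : {mpoly R[n]}) (z : 'rV[R]_n.+1) :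
  (msize p <= d)%N -> z 0 ord0 = 0 -> (homogenize d p).@[z 0] = 0.
Proof.
move=> hp z0; rewrite rmorph_sum /= big_seq_cond big1 // => a /andP[aq _].
rewrite mevalZ mevalM [X in _ * (_ * X)]rmorphXn /= mevalXU z0 expr0n.
by rewrite subn_eq0 leqNgt (leq_trans (msize_mdeg_lt aq) hp) !mulr0.
Qed.

End Dehomogenization.

(** * From the sphere to affine space *)

Lemma scaled_sandwich (R : comNzRingType) p l (a : R) (M : 'M[R]_p) (X : 'M[R]_(p, l)) :
  (a *: X)^T *m M *m (a *: X) = a ^+ 2 *: (X^T *m M *m X).
Proof. by rewrite [(_ *: _)^T]linearZ /= -!scalemxAl -scalemxAr scalerA. Qed.

Section Transfer.
Variables (R : realType) (n : nat).

(** If A and B are the even and the odd part of Q, the average of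
    (A + s B)^T M (A + s B) over the two signs of s is A^T M A + s^2 B^T M B,
    and s^2 = 1 + sum_i x_i^2 distributes the second term over B and the
    x_i B. *)
Definition dehom_pieces p l (k : nat) (Q : 'M[{mpoly R[n.+1]}]_(p, l)) :
  seq 'M[{mpoly R[n]}]_(p, l) :=
  map_mx (dehom k false) Q :: map_mx (dehom k true) Q ::
  [seq 'X_i *: map_mx (dehom k true) Q | i <- enum 'I_n].

Lemma degle_dehom_pieces p l k (Q : 'M[{mpoly R[n.+1]}]_(p, l)) T :
  (forall a b, degle k (Q a b)) -> T \in dehom_pieces k Q ->
  forall a b, degle k (T a b).
Proof.
move=> hQ; rewrite !inE => /or3P[/eqP ->|/eqP ->|/mapP[i _ ->]] a b; rewrite !mxE.
- exact: degle_dehom.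
- exact: degle_dehom.
- exact: degle_Xdehom.
Qed.

Lemma dehom_pieces_sandwich p l k (Q : 'M[{mpoly R[n.+1]}]_(p, l))
    (M : 'M[R]_p) (s : R) (x : 'rV[R]_n) :
  (forall a b, degle k (Q a b)) -> s ^+ 2 = (onepsq R n).@[x 0] ->
  let sandwich (X : 'M[R]_(p, l)) := X^T *m M *m X in
  \sum_(T <- dehom_pieces k Q) sandwich (mxeval T x)
  = (s ^+ (2 * k) / 2) *: (sandwich (mxeval Q (hpoint s x)) +
                           sandwich (mxeval Q (hpoint (- s) x))).
Proof.
move=> hQ hs sandwich; rewrite /sandwich.
have hs' : (- s) ^+ 2 = (onepsq R n).@[x 0] by rewrite sqrrN.
set A := mxeval (map_mx (dehom k false) Q) x.
set B := mxeval (map_mx (dehom k true) Q) x.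
have E t : t ^+ 2 = (onepsq R n).@[x 0] ->
    t ^+ k *: mxeval Q (hpoint t x) = A + t *: B.
  by move=> ht; apply/matrixP => a b; rewrite !mxE dehomE.
have E2 t : t ^+ 2 = (onepsq R n).@[x 0] -> t ^+ (2 * k) *:
    ((mxeval Q (hpoint t x))^T *m M *m mxeval Q (hpoint t x)) =
    (A + t *: B)^T *m M *m (A + t *: B).
  by move=> ht; rewrite -(E t ht) scaled_sandwich -exprM mulnC.
have es : s ^+ (2 * k) = (- s) ^+ (2 * k) by rewrite !exprM sqrrN.
rewrite mulrC -scalerA scalerDr (E2 s hs) es (E2 (- s) hs').
rewrite !big_cons big_map big_enum /= -/A -/B.
have -> : \sum_i (mxeval ('X_i *: map_mx (dehom k true) Q) x)^T *m M *m
    mxeval ('X_i *: map_mx (dehom k true) Q) x =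
    (s ^+ 2 - 1) *: (B^T *m M *m B).
  rewrite hs onepsqE addrAC subrr add0r scaler_suml; apply: eq_bigr => i _.
  by rewrite mxevalZ mevalXU -/B scaled_sandwich.
have T t : (A + t *: B)^T = A^T + t *: B^T by rewrite linearD linearZ.
rewrite !T !(mulmxDl, mulmxDr) -!scalemxAl -!scalemxAr.
move: (A^T *m M *m A) (A^T *m M *m B) (B^T *m M *m A) (B^T *m M *m B) => a b c d.
by apply/matrixP => i j; rewrite !mxE; field.
Qed.

Lemma QM_seq m l (G : 'M[{mpoly R[n]}]_m) k
    (Qs : seq 'M[{mpoly R[n]}]_l) (Ps : seq 'M[{mpoly R[n]}]_(m, l)) :
  (forall Q, Q \in Qs -> forall a b, degle k (Q a b)) ->
  (forall P, P \in Ps -> (uphalf (mxdeg G) <= k)%N /\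
     forall a b, degle (k - uphalf (mxdeg G)) (P a b)) ->
  QM G l (2 * k)%N
    (\sum_(Q <- Qs) Q^T *m Q + \sum_(P <- Ps) P^T *m G *m P).
Proof.
move=> hQ hP; exists (size Qs), (fun i => nth 0 Qs i), (size Ps), (fun i => nth 0 Ps i).
split; last by rewrite [X in X + _](big_nth 0) [X in _ + X](big_nth 0) !big_mkord.
- move=> i; rewrite leq_mul2l /=; apply/bigmax_leqP => a _; apply/bigmax_leqP => b _.
  by rewrite -degleP; apply/hQ/mem_nth.
- move=> i a b _; have [ck /(_ a b)] := hP _ (mem_nth 0 (ltn_ord i)).
  rewrite degleP => h.
  (* The bound is the ceiling of k - deg G / 2. *)
  rewrite -(ler_int R); apply: le_trans (Num.Theory.ceil_ge _).
  apply: (@le_trans _ _ (k - uphalf (mxdeg G))%N%:R).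
    by rewrite -pmulrn ler_nat.
  rewrite natrB // natrM mulrAC divff ?mul1r; last by rewrite pnatr_eq0.
  rewrite lerD2l lerN2 ler_pdivrMr // -natrM ler_nat uphalf_half; lia.
Qed.

Lemma mxeval_Ghat m (G : 'M[{mpoly R[n]}]_m) (s : R) (x : 'rV[R]_n) : s != 0 ->
  s ^+ (2 * uphalf (mxdeg G)) *: mxeval (Ghat G) (hpoint s x) = mxeval G x.
Proof.
move=> s0; apply/matrixP => a b; rewrite !mxE mevalM rmorphXn /= mevalXU mxE.
rewrite unlift_none mulr1; set d := mxdeg G.
have dle : degle d (G a b).
  by rewrite degleP; apply: leq_trans (leq_bigmax a); apply: leq_trans (leq_bigmax b).
have d2 : (d <= 2 * uphalf d)%N by rewrite uphalf_half; lia.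
rewrite -[RHS](homogenizeE x dle s0) mulrA; congr (_ * _).
by rewrite -{1}(subnK d2) exprD exprVn mulrAC mulfV ?mul1r ?expf_neq0.
Qed.

(** Both points (1, x) / s and - (1, x) / s are on the sphere.  Averaging the
    identity over them, after multiplication by s^(2 k), cancels the odd powers
    of s.  The degree of P drops by c, which pays for
    s^(2 c) Ghat((1, x) / s) = G(x). *)
Lemma QM_of_sphere m l (G : 'M[{mpoly R[n]}]_m) k (A : 'rV[R]_n.+1 -> 'M[R]_l)
    (B : 'M[{mpoly R[n]}]_l) :
  sphere_qm (Ghat G) (uphalf (mxdeg G)) k A ->
  (forall (s : R) (x : 'rV[R]_n), s ^+ 2 = (onepsq R n).@[x 0] ->
     mxeval B x = s ^+ (2 * k) *: A (hpoint s x)) ->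
  QM G l (2 * k)%N B.
Proof.
move=> [Qs [Ps [hQ hP hA]]] hB; set c := uphalf _ in hP.
have -> : B = \sum_(T <- flatten [seq dehom_pieces k Q | Q <- Qs]) T^T *m T +
    \sum_(T <- flatten [seq dehom_pieces (k - c) P | P <- Ps]) T^T *m G *m T.
  apply/matrixP => a b; apply: meval_inj => x.
  pose s := Num.sqrt (onepsq R n).@[x 0].
  have hs : s ^+ 2 = (onepsq R n).@[x 0] by rewrite sqr_sqrtr // ltW ?onepsq_gt0.
  have hs' : (- s) ^+ 2 = (onepsq R n).@[x 0] by rewrite sqrrN.
  have s0 : s != 0 by rewrite sqrtr_eq0 -ltNge onepsq_gt0.
  have Hx : mxeval B x = (s ^+ (2 * k) / 2) *: (A (hpoint s x) + A (hpoint (- s) x)).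
    rewrite mulrC -scalerA scalerDr -hB // (_ : s ^+ (2 * k) = (- s) ^+ (2 * k)).
      by rewrite -hB // -mulr2n -scaler_nat scalerA mulVf ?scale1r // pnatr_eq0.
    by rewrite !exprM sqrrN.
  suff /matrixP/(_ a b) : mxeval B x = mxeval (
    \sum_(T <- flatten [seq dehom_pieces k Q | Q <- Qs]) T^T *m T +
    \sum_(T <- flatten [seq dehom_pieces (k - c) P | P <- Ps]) T^T *m G *m T) x.
    by rewrite ![mxeval _ _ _ _]mxE.
  rewrite Hx mxevalD !mxeval_sum !big_flatten !big_map.
  rewrite hA ?hA; [|exact: hpoint_sphere..].
  rewrite addrACA -!big_split /= scalerDr !scaler_sumr; congr (_ + _).
    rewrite big_seq [RHS]big_seq; apply: eq_bigr => Q Qin.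
    have := dehom_pieces_sandwich 1%:M (hQ _ Qin) hs; rewrite /= !mulmx1 => <-.
    by apply: eq_bigr => T _; rewrite mulmx1 mxevalM mxevalT.
  rewrite big_seq [RHS]big_seq; apply: eq_bigr => P Pin.
  have [ck dP] := hP _ Pin.
  have es j : (- s) ^+ (2 * j) = s ^+ (2 * j) by rewrite !exprM sqrrN.
  have E t (X : 'M[R]_(m, l)) : t != 0 -> (forall j, t ^+ (2 * j) = s ^+ (2 * j)) ->
     s ^+ (2 * k) *: (X^T *m mxeval (Ghat G) (hpoint t x) *m X) =
     s ^+ (2 * (k - c)) *: (X^T *m mxeval G x *m X).
    move=> t0 et; rewrite -(mxeval_Ghat G x t0) -scalemxAr -scalemxAl scalerA et.
    by rewrite -exprD -mulnDr subnK.
  have := dehom_pieces_sandwich (mxeval G x) dP hs; rewrite /=.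
  rewrite ![_ / 2]mulrC -!scalerA !scalerDr (E s) // (E (- s)) ?oppr_eq0 //.
  move=> <-.
  by apply: eq_bigr => T _; rewrite !mxevalM mxevalT.
apply: QM_seq => [Q /flattenP[_ /mapP[Q' Q'in ->]]|P /flattenP[_ /mapP[P' P'in ->]]].
  by move=> Qin; apply: degle_dehom_pieces Qin; apply: hQ.
move=> Pin; have [ck dP] := hP _ P'in; split=> //.
exact: degle_dehom_pieces Pin.
Qed.

End Transfer.

(** * Barycentric coordinates of the simplex *)

Section Barycentric.
Variables (R : realType) (n : nat).
Local Notation N := n.+1.
Implicit Type z : 'rV[R]_N.

Definition simplex z :=
  0 <= Num.sqrt N%:R - \sum_(i < N) z 0 i /\ forall i, 0 <= 1 + z 0 i.

(** The coordinate of index ord0 belongs to the facet on which the z_i have sum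
    sqrt N, the one of index lift ord0 i to the facet z_i = -1. *)
Definition bary (a : 'I_N.+1) z : R :=
  (if unlift ord0 a is Some i then 1 + z 0 i
   else Num.sqrt N%:R - \sum_(i < N) z 0 i) / (N%:R + Num.sqrt N%:R).

Lemma bary_den_gt0 : 0 < N%:R + Num.sqrt N%:R :> R.
Proof. by rewrite ltr_pwDl ?ltr0n ?sqrtr_ge0. Qed.

Lemma bary_den_ge1 : 1 <= N%:R + Num.sqrt N%:R :> R.
Proof. by rewrite -[leLHS]addr0 lerD ?sqrtr_ge0 ?ler1n. Qed.

Lemma sum_bary z : \sum_a bary a z = 1.
Proof.
rewrite -mulr_suml big_ord_recl unlift_none.
rewrite [X in _ + X](eq_bigr (fun i => 1 + z 0 i)); last by move=> i _; rewrite liftK.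
rewrite big_split /= sumr_const card_ord.
rewrite (_ : _ + _ = N%:R + Num.sqrt N%:R); last by ring.
by rewrite mulfV // gt_eqF ?bary_den_gt0.
Qed.

Lemma bary_ge0 z a : simplex z -> 0 <= bary a z.
Proof.
move=> [h0 h]; apply: divr_ge0; last exact: ltW bary_den_gt0.
by case: unliftP.
Qed.

Lemma bary_surj (p : 'I_N.+1 -> R) : (forall a, 0 <= p a) -> \sum_a p a = 1 ->
  exists2 z, simplex z & forall a, bary a z = p a.
Proof.
move=> p0 p1; set c : R := N%:R + Num.sqrt N%:R.
have c0 : 0 < c by apply: bary_den_gt0.
pose z : 'rV[R]_N := \row_i (c * p (lift ord0 i) - 1).
have e0 : Num.sqrt N%:R - \sum_(i < N) z 0 i = c * p ord0.
  under eq_bigr => i _ do rewrite mxE.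
  rewrite sumrB sumr_const card_ord -mulr_sumr.
  move: p1; rewrite big_ord_recl => /eqP; rewrite eq_sym -subr_eq => /eqP <-.
  by rewrite /c; ring.
have ei i : 1 + z 0 i = c * p (lift ord0 i) by rewrite mxE; ring.
exists z.
  split; first by rewrite e0 mulr_ge0 // ltW.
  by move=> i; rewrite ei mulr_ge0 // ltW.
move=> a; rewrite /bary -/c; case: unliftP => [i ->|->]; rewrite ?ei ?e0;
  by rewrite mulrAC mulfV ?mul1r // gt_eqF.
Qed.

(** Every facet is tangent to the sphere.  On the sphere,
    sqrt N - sum_j z_j = (sqrt N / 2) sum_j (z_j - 1 / sqrt N)^2 and
    1 + z_i = ((1 + z_i)^2 + sum_(j <> i) z_j^2) / 2. *)
Lemma bary_sos a : sphere_sos 1 (bary a).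
Proof.
have c0 := bary_den_gt0; set c := (_ + _) in c0.
have cV0 : 0 <= c^-1 by rewrite invr_ge0 ltW.
have X1 (i : 'I_N) : degle 1 ('X_i : {mpoly R[N]}) by apply: degleX.
case: (unliftP ord0 a) => [i ->|->]; last first.
  pose b : R := (Num.sqrt N%:R)^-1.
  have sN : 0 < Num.sqrt N%:R :> R by rewrite sqrtr_gt0 ltr0n.
  have sN2 : Num.sqrt N%:R ^+ 2 = N%:R :> R by rewrite sqr_sqrtr.
  apply: eq_sphere_sos _ (sphere_sosM (sphere_sosC N 0 (_ : 0 <= Num.sqrt N%:R / 2 / c))
    (sphere_sos_sum (index_enum 'I_N) (P := xpredT) (k := 1)
      (F := fun j z => ('X_j - b%:MP).@[z 0] ^+ 2) _)).
  - move=> z hz; rewrite /bary unlift_none -/c.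
    under eq_bigr => j _ do rewrite mevalB mevalXU mevalC sqrrB.
    rewrite big_split /= sumr_const card_ord sumrB hz.
    rewrite sumrMnl -mulr_suml -(mulr_natr (b ^+ 2)) /b.
    move: (\sum_(i < N) z 0 i) (Num.sqrt N%:R) sN sN2 c c0 {cV0 b} => S sq sN <- c c0.
    by field; rewrite !gt_eqF.
  - by apply: mulr_ge0 => //; apply: mulr_ge0; rewrite ?sqrtr_ge0 ?invr_ge0.
  - move=> j _; apply: sphere_sos_sqr; apply: degleD => //; apply: degleN.
    exact: degleC.
apply: eq_sphere_sos _ (sphere_sosM (sphere_sosC N 0 (_ : 0 <= 2^-1 / c))
    (sphere_sosD (sphere_sos_sqr (q := 1 + 'X_i) _)
     (sphere_sos_sum (index_enum 'I_N) (P := fun j => j != i) (k := 1)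
      (F := fun j z => ('X_j).@[z 0] ^+ 2) _))).
- move=> z hz; rewrite /bary liftK -/c mevalD meval1 mevalXU.
  under eq_bigr => j _ do rewrite mevalXU.
  move: hz; rewrite /unit_sphere (bigD1 i) //= => /eqP; rewrite eq_sym addrC -subr_eq => /eqP <-.
  by field; rewrite gt_eqF.
- by rewrite mulr_ge0 // invr_ge0.
- by apply: degleD => //; apply: degle1.
- by move=> j _; apply: sphere_sos_sqr.
Qed.

Lemma sphere_simplex z : unit_sphere z -> simplex z.
Proof.
move=> hz.
have h a : 0 <= bary a z.
  have [qs [_ ->]] := bary_sos a => //.
  by apply: sumr_ge0 => q _; rewrite sqr_ge0.
have c0 := bary_den_gt0; split=> [|i].
  by have := h ord0; rewrite /bary unlift_none pmulr_lge0 // invr_gt0.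
by have := h (lift ord0 i); rewrite /bary liftK pmulr_lge0 // invr_gt0.
Qed.

(** The variables are affine functions of the letters. *)
Lemma coef_tree_mpoly (q : {mpoly R[N]}) : exists (D : nat) (L : R), 0 <= L /\
  coef_tree bary D (- L) L (fun z => q.@[z 0]).
Proof.
pose good (phi : 'rV[R]_N -> R) := exists (D : nat) (L : R), 0 <= L /\ coef_tree bary D (- L) L phi.
have good_eq phi phi' : phi =1 phi' -> good phi -> good phi'.
  by move=> e [D [L [L0 h]]]; exists D, L; split=> //; apply: eq_coef_tree h.
have goodC c : good (fun=> c).
  by exists 0, `|c|; split=> //; apply: coef_tree_cst.
have goodM phi phi' : good phi -> good phi' -> good (fun z => phi z * phi' z).
  move=> [D [L [L0 h]]] [D' [L' [L0' h']]]; exists (D + D')%N, (L * L').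
  by split; [apply: mulr_ge0|apply: coef_treeM].
have goodD phi phi' : good phi -> good phi' -> good (fun z => phi z + phi' z).
  move=> [D [L [L0 h]]] [D' [L' [L0' h']]]; exists (maxn D D'), (L + L').
  split; first exact: addr_ge0.
  rewrite opprD; apply: coef_treeD; first exact: (coef_tree_le sum_bary (leq_maxl D D') h).
  exact: (coef_tree_le sum_bary (leq_maxr D D') h').
have good_sum (I : Type) (r : seq I) (F : I -> 'rV[R]_N -> R) :
    (forall i, good (F i)) -> good (fun z => \sum_(i <- r) F i z).
  move=> h; elim: r => [|i r IH].
    by apply: (good_eq (fun=> 0)) => // z; rewrite big_nil.
  by apply: good_eq (goodD _ _ (h i) IH) => z; rewrite big_cons.
have good_prod (I : Type) (r : seq I) (F : I -> 'rV[R]_N -> R) :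
    (forall i, good (F i)) -> good (fun z => \prod_(i <- r) F i z).
  move=> h; elim: r => [|i r IH].
    by apply: (good_eq (fun=> 1)) => // z; rewrite big_nil.
  by apply: good_eq (goodM _ _ (h i) IH) => z; rewrite big_cons.
have good_exp phi k : good phi -> good (fun z => phi z ^+ k).
  move=> h; elim: k => [|k IH]; first exact: (goodC 1).
  by apply: good_eq (goodM _ _ h IH) => z; rewrite exprS.
have good_coord i : good (fun z => z 0 i).
  have c0 := bary_den_gt0; set c := (_ + _) in c0.
  have H : good (bary (lift ord0 i)).
    by exists 1, 1; split=> //; apply: coef_tree_letter.
  apply: good_eq (goodD _ _ (goodM _ _ (goodC c) H) (goodC (- 1))) => z.
  by rewrite /bary liftK -/c; field; rewrite gt_eqF.
rewrite -/(good _); apply: good_eq (good_sum _ (msupp q) _ _) => [z|].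
  by rewrite mevalE.
by move=> a; apply: goodM => //; apply: good_prod => i; apply: good_exp.
Qed.

Lemma bary_dist z z' :
  \sum_a `|bary a z - bary a z'| <= 2 * \sum_(i < N) `|z 0 i - z' 0 i|.
Proof.
have c0 := bary_den_gt0; have c1 := bary_den_ge1; rewrite big_ord_recl /bary unlift_none.
set c := (_ + _) in c0 c1 *.
rewrite [X in _ + X](eq_bigr (fun i => `|(1 + z 0 i) / c - (1 + z' 0 i) / c|)); last first.
  by move=> i _; rewrite liftK.
have cV0 : 0 <= c^-1 by rewrite invr_ge0 ltW.
have H (x x' d : R) : `|x - x'| <= d -> `|x / c - x' / c| <= d.
  move=> h; rewrite -mulrBl normrM (ger0_norm cV0).
  rewrite ler_pdivrMr //; apply: le_trans (h) _; rewrite ler_peMr //.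
  by apply: le_trans h; apply: normr_ge0.
rewrite mulr_natl mulr2n; apply: lerD.
  apply: H; rewrite (_ : _ - _ = \sum_(i < N) (z' 0 i - z 0 i)); last by rewrite sumrB; ring.
  by apply: le_trans (ler_norm_sum _ _ _) _; apply: ler_sum => i _; rewrite distrC.
apply: ler_sum => i _; apply: H.
by rewrite opprD addrACA subrr add0r.
Qed.

End Barycentric.

(** * Polya theorem for matrices and the penalty terms *)

Section Words.
Variables (R : realType) (n m : nat) (G : 'M[{mpoly R[n.+1]}]_m) (c0 : nat).

(** The word of length K formed by letters of the simplex is a sum of squares
    on the sphere, and Polya theorem makes its coefficient positive
    semidefinite. *)
Lemma sphere_qm_words l D K (c : {ffun 'I_D -> 'I_n.+2} -> 'M[R]_l) (L mu : R) :
  (forall w, (c w)^T = c w) ->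
  (forall w u, `|qform (c w) u| <= L * sqnorm u) ->
  (forall z, simplex z -> forall u, mu * sqnorm u <=
     qform (\sum_(w : {ffun 'I_D -> 'I_n.+2}) (\prod_j bary (w j) z) *: c w) u) ->
  (0 < K)%N -> (D <= K)%N -> (D ^ 2)%:R * L <= K%:R * mu ->
  sphere_qm G c0 K (fun z => \sum_(w : {ffun 'I_D -> 'I_n.+2}) (\prod_j bary (w j) z) *: c w).
Proof.
move=> symc cL hmu K0 DK hL.
pose C (v : {ffun 'I_K -> 'I_n.+2}) : 'M[R]_l :=
  \sum_(i : {ffun 'I_D -> 'I_K} | injectiveb i) c [ffun j => v (i j)].
have symC v : (C v)^T = C v.
  by rewrite /C linear_sum; apply: eq_bigr => i _; apply: symc.
have psdC v : psdmx (C v).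
  move=> u; rewrite -/(qform (C v) u) /C qform_sum.
  apply: (@sampling_ge0 R _ D K (fun w => qform (c w) u) (L * sqnorm u) (mu * sqnorm u)) => //.
    move=> p p0 p1; have [z hz zp] := bary_surj p0 p1.
    apply: le_trans (hmu z hz u) _; rewrite qform_sum le_eqVlt; apply/orP; left.
    apply/eqP; apply: eq_bigr => w _; rewrite qformZ; congr (_ * _).
    by apply: eq_bigr => j _; rewrite zp.
  by rewrite !mulrA; apply: ler_wpM2r => //; apply: sqnorm_ge0.
have f0 : 0 < (K ^_ D)%:R :> R by rewrite ltr0n ffact_gt0.
apply: eq_sphere_qm _ (sphere_qm_sosM (k := 0) (k' := K)
  (sphere_sosC n.+1 0 (_ : 0 <= (K ^_ D)%:R^-1))
  (sphere_qm_sum (index_enum {ffun 'I_K -> 'I_n.+2})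
     (F := fun v z => (\prod_s bary (v s) z) *: C v) _)).
- move=> z _; rewrite (sampling_identity K c (sum_bary z)) scalerA mulVf ?scale1r //.
  by rewrite gt_eqF.
- by rewrite invr_ge0.
move=> v; have H : sphere_sos (K * 1) (fun z : 'rV[R]_n.+1 => \prod_s bary (v s) z).
  pose F i := bary (if insub i is Some s then v s else ord0) : 'rV[R]_n.+1 -> R.
  apply: eq_sphere_sos _ (sphere_sos_prod (F := F) (k := 1) K _); last first.
    by move=> i; apply: bary_sos.
  by move=> z _; apply: eq_bigr => s _; rewrite /F valK.
by have := sphere_qm_sosM H (sphere_qm_psd G c0 0 (symC v) (psdC v)); rewrite muln1 addn0.
Qed.

End Words.

Section Walk.
Variable R : realType.

Lemma walk_poly N m s k (g : {mpoly R[N]}) : degle k g ->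
  exists2 H : {mpoly R[N]}, degle (m * k) H & forall z : 'rV[R]_N, H.@[z 0] = walk m s g.@[z 0].
Proof.
move=> hg; elim: m s => [|m IH] s.
  by exists ((s <= 0)%R%:R)%:MP => [|z]; rewrite ?mevalC //; apply: degleC.
have [H1 d1 e1] := IH (s + 1); have [H2 d2 e2] := IH (s - 1).
exists (2^-1 *: (1 + g) * H1 + 2^-1 *: (1 - g) * H2) => [|z]; last first.
  by rewrite /= mevalD !mevalM !mevalZ mevalD mevalB meval1 e1 e2; field.
have d1g : degle k (2^-1 *: (1 + g)) by apply/degleZ/degleD => //; apply: degle1.
have d2g : degle k (2^-1 *: (1 - g)).
  by apply/degleZ/degleD; [apply: degle1|apply: degleN].
by rewrite mulSn; apply: degleD; apply: degleM.
Qed.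

(** For t >= 0 the walk, which starts at m d / 2 and has a nonnegative drift,
    rarely ends at or below 0; for t < 0 the left side is not positive. *)
Lemma penalty_small m (d t : R) : 0 < d -> (0 < m)%N -> -1 <= t <= 1 ->
  walk m (m%:R * d / 2) t ^+ 2 * t <= (4 / (m%:R * d ^+ 2)) ^+ 2.
Proof.
move=> d0 m0 /andP[t1 t2]; have m0' : 0 < m%:R :> R by rewrite ltr0n.
have [t0|t0] := ltP t 0.
  apply: (@le_trans _ _ 0); last exact: sqr_ge0.
  by rewrite mulr_ge0_le0 ?sqr_ge0 // ltW.
have ht : 0 <= t <= 1 by rewrite t0.
have q0 : 0 < m%:R * d ^+ 2 by rewrite mulr_gt0 ?exprn_gt0.
have ht1 : -1 <= t <= 1 by rewrite t1.
have /andP[w0 _] := walk_range m (m%:R * d / 2) ht1.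
have := walk_small m d0 ht; rewrite -ler_pdivlMr // => h.
apply: (@le_trans _ _ (walk m (m%:R * d / 2) t ^+ 2)).
  by rewrite ler_piMr ?sqr_ge0.
by rewrite ler_pXn2r ?nnegrE // divr_ge0 // ltW.
Qed.

(** For t <= - d the walk ends at or below 0 with probability at least 1/2. *)
Lemma penalty_large m (d t : R) : 0 < d -> -1 <= t <= - d ->
  8 <= m%:R * d ^+ 2 -> walk m (m%:R * d / 2) t ^+ 2 * t <= - (d / 4).
Proof.
move=> d0 ht h8; have := walk_large m d0 ht.
move: (walk _ _ _) => w h; have /andP[t1 t2] := ht.
have w2 : 2^-1 <= w.
  rewrite leNgt; apply/negP => wl; have w1 : 0 <= 2^-1 - w by lra.
  have w2 : 0 <= 1 - w by lra.
  by have := ler_wpM2l w2 h8; lra.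
have w4 : 4^-1 <= w ^+ 2.
  have -> : 4^-1 = 2^-1 * 2^-1 :> R by field.
  by rewrite expr2; apply: ler_pM => //; rewrite invr_ge0.
apply: (@le_trans _ _ (w ^+ 2 * - d)); first by rewrite ler_wpM2l ?sqr_ge0.
by rewrite mulrN lerN2 [leRHS]mulrC ler_wpM2l // ltW.
Qed.
End Walk.

(** * The perturbed form *)

(** The walk of the penalties has a length m with M <= m del^3 eps <= M + 1, and
    lam is their weight.  The third condition bounds the harm done
    by the penalties where the constraints hold.  The last one is the condition
    of Polya theorem for words of length at most 3 m e with coefficients at
    most L0 / del: since m is of order 1 / (del^3 eps), the length of the words
    squared over del eps is of order 1 / (del^7 eps^3). *)
Lemma parameter_choice (R : realType) (B r e eps del : R) :
  1 <= B -> 0 <= r -> 1 <= e -> 0 < eps <= 1 -> 0 < del <= 1 ->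
  let M := 8 + 256 * B * r in let L0 := B + 1 + 4 * B * r in
  let lam := 4 * B / del in
  exists m : nat, [/\ (0 < m)%N, 8 <= m%:R * del ^+ 2,
    lam * (r * (4 / (m%:R * del ^+ 2)) ^+ 2) <= eps / 4 &
    forall k : R, 18 * e ^+ 2 * L0 * (M + 1) ^+ 2 <= k * (del ^+ 7 * eps ^+ 3) ->
      (3 * m%:R * e) ^+ 2 * (L0 / del) <= k * (eps / 2)].
Proof.
move=> B1 r0 e1 /andP[p0 p1] /andP[d0 d1] M L0 lam.
have Br0 : 0 <= B * r by apply: mulr_ge0; lra.
have M8 : 8 <= M by rewrite /M -mulrA; lra.
have L1 : 1 <= L0 by rewrite /L0 -mulrA; lra.
have q0 : 0 < del ^+ 3 * eps by rewrite mulr_gt0 ?exprn_gt0.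
have d31 : del ^+ 3 <= 1 by rewrite exprn_ile1 // ltW.
have d0' := ltW d0; have p0' := ltW p0.
have q1 : del ^+ 3 * eps <= 1 by apply: mulr_ile1 => //; apply: exprn_ge0.
have de1 : del * eps <= 1 by apply: mulr_ile1.
have x0 : 0 <= M / (del ^+ 3 * eps) by apply: divr_ge0; [lra|apply: ltW].
have := truncn_itv x0; set k0 := Num.truncn _ => /andP[h1 h2].
pose m := k0.+1; exists m; set x := m%:R.
have xlo : M <= x * (del ^+ 3 * eps) by rewrite -ler_pdivrMr // ltW.
have xhi : x * (del ^+ 3 * eps) <= M + 1.
  rewrite /x /m -natr1 mulrDl mul1r lerD //; by rewrite -ler_pdivlMr.
have xpos : 0 < x by rewrite ltr0n.
have sq : M ^+ 2 <= (x * (del ^+ 3 * eps)) ^+ 2.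
  by rewrite ler_pXn2r ?nnegrE //; lra.
have sq' : (x * (del ^+ 3 * eps)) ^+ 2 <= (M + 1) ^+ 2.
  by rewrite ler_pXn2r ?nnegrE //; lra.
have d2 : 0 < del ^+ 2 by rewrite exprn_gt0.
split=> //.
- apply: le_trans M8 (le_trans xlo _); apply: ler_wpM2l; first exact: ltW.
  by rewrite exprSr -mulrA -[leRHS]mulr1; apply: ler_wpM2l => //; apply: ltW.
- have H : 256 * (B * r) <= x ^+ 2 * del ^+ 5 * eps.
    apply: (@le_trans _ _ (M ^+ 2)).
      by apply: (@le_trans _ _ M); [rewrite /M -mulrA; lra|nra].
    apply: le_trans sq _.
    have -> : (x * (del ^+ 3 * eps)) ^+ 2 = x ^+ 2 * del ^+ 5 * eps * (del * eps) by ring.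
    rewrite -[leRHS]mulr1; apply: ler_wpM2l => //.
    by apply: mulr_ge0 => //; apply: mulr_ge0; apply: exprn_ge0; rewrite ?ltW.
  have -> : lam * (r * (4 / (x * del ^+ 2)) ^+ 2) = 64 * (B * r) / (x ^+ 2 * del ^+ 5).
    by rewrite /lam; field; rewrite !gt_eqF.
  rewrite ler_pdivrMr; last by rewrite mulr_gt0 ?exprn_gt0.
  have -> : eps / 4 * (x ^+ 2 * del ^+ 5) = x ^+ 2 * del ^+ 5 * eps / 4 by field.
  by lra.
- move=> k hk.
  have d7 : 0 < del ^+ 7 * eps ^+ 2 by rewrite mulr_gt0 ?exprn_gt0.
  rewrite -(ler_pM2r d7).
  have -> : (3 * x * e) ^+ 2 * (L0 / del) * (del ^+ 7 * eps ^+ 2) =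
      9 * e ^+ 2 * L0 * (x * (del ^+ 3 * eps)) ^+ 2 by field; rewrite gt_eqF.
  have -> : k * (eps / 2) * (del ^+ 7 * eps ^+ 2) = k * (del ^+ 7 * eps ^+ 3) / 2 by field.
  have c0 : 0 <= 9 * e ^+ 2 * L0 by rewrite !mulr_ge0 ?exprn_ge0 //; lra.
  have := ler_wpM2l c0 sq'; lra.
Qed.

Lemma word_length_le (k e : nat) : (0 < k)%N -> (k * e + (k * e + e) <= 3 * k * e)%N.
Proof.
move=> k0; have ke : (e <= k * e)%N by rewrite leq_pmull.
by rewrite -mulnA; move: (k * e)%N ke => x; lia.
Qed.

Section Core.
Variables (R : realType) (n m : nat) (G : 'M[{mpoly R[n.+1]}]_m) (c0 : nat).
Local Notation N := n.+1.

Lemma sum_words D (z : 'rV[R]_N) :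
  \sum_(w : {ffun 'I_D -> 'I_N.+1}) \prod_j bary (w j) z = 1.
Proof.
rewrite -(bigA_distr_bigA (fun (_ : 'I_D) a => bary a z)) /= big1 // => j _.
exact: sum_bary.
Qed.

(** The form f + eps - lam sum_i tau_i, where tau_i = walk(g_i)^2 g_i, is at
    least eps / 2 on the simplex.  Where all g_i >= - del, the assumption gives
    f >= - eps / 4 and the penalties cost at most eps / 4.  Elsewhere one of
    the tau_i is at most - del / 4, and lam del / 4 = B outweighs f.  Polya
    theorem certifies this form, and the tau_i are certified because the g_i
    are. *)
Lemma core_certificate l (f : 'M[{mpoly R[N]}]_l) (I : finType) (g : I -> {mpoly R[N]})
    (e : nat) (Lf : R) :
  f^T = f -> (0 < e)%N -> 0 <= Lf ->
  (forall a b, coef_tree (@bary R n) e (- Lf) Lf (fun z => (f a b).@[z 0])) ->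
  (forall i, coef_tree (@bary R n) e (-1) 1 (fun z => (g i).@[z 0])) ->
  (forall i, degle e (g i)) ->
  (forall i, sphere_qm G c0 e (fun z => (g i).@[z 0]%:M : 'M[R]_l)) ->
  exists2 C : R, 0 < C & forall eps del, 0 < eps <= 1 -> 0 < del <= 1 ->
    (forall z, simplex z -> (forall i, - del <= (g i).@[z 0]) ->
       forall u, - (eps / 4) * sqnorm u <= qform (mxeval f z) u) ->
    forall K : nat, C <= K%:R * (del ^+ 7 * eps ^+ 3) ->
    sphere_qm G c0 K (fun z => mxeval f z + eps%:M).
Proof.
move=> symf e0 Lf0 repf repg degg qmg.
have e1 : 1 <= e%:R :> R by rewrite ler1n.
pose B : R := Lf * l%:R + 1; pose r : R := #|I|%:R.
have B1 : 1 <= B by rewrite ler_wpDl // mulr_ge0.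
have r0 : 0 <= r by [].
pose M := 8 + 256 * B * r; pose L0 := B + 1 + 4 * B * r.
have Br0 : 0 <= B * r by apply: mulr_ge0; lra.
have L1 : 1 <= L0 by rewrite /L0 -mulrA; lra.
have M0 : 0 <= M by rewrite /M -mulrA; lra.
exists (18 * e%:R ^+ 2 * L0 * (M + 1) ^+ 2).
  by rewrite !mulr_gt0 ?exprn_gt0 //; lra.
move=> eps del heps hdel hf K hK.
have /andP[p0 p1] := heps; have /andP[d0 d1] := hdel.
have [k [k0 k8 hlam hk]] := parameter_choice B1 r0 e1 heps hdel.
have {hk} hk := hk _ hK.
pose lam := 4 * B / del; set nu := 4 / (k%:R * del ^+ 2) in hlam.
have lam0 : 0 <= lam by rewrite divr_ge0 //; lra.
pose s0 : R := k%:R * del / 2.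
have [H degH HE] := fin_all_exists2 (fun i => walk_poly k s0 (degg i)).
pose tau i (z : 'rV[R]_N) := (H i).@[z 0] ^+ 2 * (g i).@[z 0].
pose D := (k * e + (k * e + e))%N.
have reptau i : coef_tree (@bary R n) D (-1) 1 (tau i).
  have rH : coef_tree (@bary R n) (k * e) (-1) 1 (fun z => (H i).@[z 0]).
    apply: (@coef_tree_wide _ _ _ _ _ 0 1) => //; first by lra.
    apply: eq_coef_tree (coef_tree_walk (@sum_bary R n) k s0 (repg i)) => z.
    by rewrite HE.
  have := coef_treeM ler01 (mulr_ge0 ler01 ler01) rH
    (coef_treeM ler01 ler01 rH (repg i)); rewrite !mulr1.
  by apply: eq_coef_tree => z; rewrite /tau expr2 mulrA.
have eD : (e <= D)%N by rewrite /D addnA leq_addl.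
have [cf hcf] := fin_all_exists (fun p : 'I_l * 'I_l =>
  coef_tree_words (coef_tree_le (@sum_bary R n) eD (repf p.1 p.2))).
have [ct hct] := fin_all_exists (fun i => coef_tree_words (reptau i)).
pose Y (w : {ffun 'I_D -> 'I_N.+1}) (z : 'rV[R]_N) := \prod_j bary (w j) z.
(* Symmetrizing the coefficients changes neither their quadratic forms nor
   the sum, because f is symmetric. *)
pose cF w : 'M[R]_l := \matrix_(a, b) cf (a, b) w.
pose sc w : R := eps - lam * \sum_i ct i w.
pose c w : 'M[R]_l :=
  2^-1 *: (cF w + (cF w)^T) + (sc w)%:M.
have scE z : \sum_w Y w z * sc w = eps - lam * \sum_i tau i z.
  under eq_bigr => w _ do rewrite mulrBr.
  rewrite sumrB -mulr_suml sum_words mul1r; congr (_ - _).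
  under eq_bigr => w _ do rewrite mulrCA mulr_sumr.
  rewrite -mulr_sumr exchange_big /=; congr (_ * _); apply: eq_bigr => i _.
  by rewrite (hct i).2.
have cE z : \sum_w Y w z *: c w = mxeval f z + (eps - lam * \sum_i tau i z)%:M.
  apply/matrixP => a b; rewrite summxE !mxE -scE.
  rewrite (eq_bigr (fun w => 2^-1 * (Y w z * cf (a, b) w) +
     2^-1 * (Y w z * cf (b, a) w) + (Y w z * sc w) *+ (a == b))); last first.
    by move=> w _; rewrite !mxE mulrDr mulrnAr; congr (_ + _); ring.
  rewrite !big_split /= -!mulr_sumr sumrMnl; congr (_ + _).
  have fba : (f b a).@[z 0] = (f a b).@[z 0] by rewrite -[in LHS]symf mxE.
  have := (hcf (a, b)).2 z; have := (hcf (b, a)).2 z; rewrite /= fba => <- <-.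
  by field.
have symc w : (c w)^T = c w.
  by rewrite /c linearD /= linearZ /= linearD /= trmxK tr_scalar_mx [cF w + _]addrC.
have qcF w u : `|qform (cF w) u| <= (B - 1) * sqnorm u.
  rewrite /B addrK; apply: qform_bound => // a b; rewrite mxE ler_norml.
  by have [] := hcf (a, b).
have delV : 1 <= del^-1 by rewrite invf_ge1.
have boundc w u : `|qform (c w) u| <= L0 / del * sqnorm u.
  rewrite /c qformD qformZ qformD qformT qform_scalar.
  have N0 := sqnorm_ge0 u; set nm := sqnorm u in N0 *.
  have -> : 2^-1 * (qform (cF w) u + qform (cF w) u) = qform (cF w) u by field.
  apply: le_trans (ler_normD _ _) _; rewrite normrM (ger0_norm N0).
  apply: (@le_trans _ _ ((B - 1) * nm + (eps + lam * r) * nm)).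
    apply: lerD; first exact: qcF.
    apply: ler_wpM2r => //; apply: le_trans (ler_normB _ _) _.
    rewrite (ger0_norm (ltW p0)) lerD2l normrM (ger0_norm lam0).
    apply: ler_wpM2l => //; apply: le_trans (ler_norm_sum _ _ _) _.
    rewrite -[leRHS]mulr1 mulr_natl -sumr_const; apply: ler_sum => i _.
    by rewrite ler_norml; have [] := hct i.
  rewrite -mulrDl; apply: ler_wpM2r => //.
  have -> : L0 / del = B * del^-1 + del^-1 + lam * r by rewrite /L0 /lam; ring.
  have := ler_wpM2l (_ : 0 <= B) delV; rewrite mulr1 => /(_ _); lra.
have posc z : simplex z -> forall u, eps / 2 * sqnorm u <=
    qform (\sum_w Y w z *: c w) u.
  move=> hz u; rewrite cE qformD qform_scalar; set T := \sum_i _.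
  have N0 := sqnorm_ge0 u; set nm := sqnorm u in N0 *.
  have y0 a : 0 <= bary a z by apply: bary_ge0.
  have grange i : -1 <= (g i).@[z 0] <= 1 by apply: coef_tree_range (repg i) => //; apply: sum_bary.
  have tau_small i : tau i z <= nu ^+ 2.
    by rewrite /tau HE; apply: penalty_small.
  have [/forallP all_g|] := boolP [forall i, - del <= (g i).@[z 0]].
    have hT : lam * T <= eps / 4.
      apply: le_trans hlam; apply: ler_wpM2l => //.
      rewrite mulr_natl -sumr_const; apply: ler_sum => i _; exact: tau_small.
    have := hf z hz all_g u; rewrite -/nm.
    have := ler_wpM2r N0 hT; lra.
  rewrite negb_forall => /existsP[j]; rewrite -ltNge => gj.
  have hT : T <= - (del / 4) + r * nu ^+ 2.
    rewrite /T (bigD1 j) //=; apply: lerD.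
      rewrite /tau HE; apply: penalty_large => //.
      by have /andP[-> _] := grange j; apply: ltW.
    rewrite mulr_natl -sumr_const [leRHS](bigD1 j) //= -[leLHS]add0r.
    by apply: lerD; [apply: sqr_ge0|apply: ler_sum => i _; apply: tau_small].
  have hT' : lam * T <= eps / 4 - B.
    apply: le_trans (ler_wpM2l lam0 hT) _; rewrite mulrDr.
    have -> : lam * - (del / 4) = - B by rewrite /lam; field; rewrite gt_eqF.
    by rewrite addrC lerD2r.
  have qf : - ((B - 1) * nm) <= qform (mxeval f z) u.
    suff : `|qform (mxeval f z) u| <= (B - 1) * nm by rewrite ler_norml => /andP[].
    rewrite /B addrK; apply: qform_bound => // a b; rewrite mxE ler_norml.
    by apply: coef_tree_range (repf a b) => //; apply: sum_bary.
  by have := ler_wpM2r N0 hT'; have := mulr_ge0 (ltW p0) N0; lra.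
have D3 : D%:R <= 3 * k%:R * e%:R :> R.
  by rewrite -natrM -natrM ler_nat; apply: word_length_le.
have Ldel : 1 <= L0 / del by rewrite -[leLHS]mulr1; apply: ler_pM => //; lra.
have D2 : (D ^ 2)%:R * (L0 / del) <= K%:R * (eps / 2).
  apply: le_trans hk; apply: ler_wpM2r; first by lra.
  by rewrite natrX ler_pXn2r ?nnegrE // (le_trans _ D3).
have DK : (D <= K)%N.
  rewrite -(ler_nat R); apply: (@le_trans _ _ ((D ^ 2)%:R * (L0 / del))).
    rewrite -[leLHS]mulr1; apply: ler_pM => //.
    by rewrite ler_nat -[X in (X <= _)%N]muln1 leq_mul2l; case: (D).
  by apply: le_trans D2 _; rewrite -[leRHS]mulr1; apply: ler_wpM2l => //; lra.
have K0 : (0 < K)%N by apply: leq_trans DK; apply: leq_trans eD.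
have W := sphere_qm_words G c0 symc boundc posc K0 DK D2.
have P i : sphere_qm G c0 K (fun z => (tau i z)%:M : 'M[R]_l).
  apply: (@sphere_qm_le _ _ _ _ _ _ (k * e + e)).
    by apply: leq_trans DK; rewrite /D leq_addl.
  apply: eq_sphere_qm _ (sphere_qm_sosM (sphere_sos_sqr (degH i)) (qmg i)) => z _.
  by rewrite scale_scalar_mx.
apply: eq_sphere_qm _ (sphere_qmD W (sphere_qm_sosM (sphere_sosC N 0 lam0)
  (sphere_qm_sum (index_enum I) P))) => z _.
rewrite cE -addrA; congr (_ + _).
rewrite -(raddf_sum (@scalar_mx R l)) scale_scalar_mx -raddfD /=.
by rewrite subrK.
Qed.
End Core.

(** * Large perturbations *)

Lemma degle_mxdeg (R : realType) N p q (A : 'M[{mpoly R[N]}]_(p, q)) a b :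
  degle (mxdeg A) (A a b).
Proof.
by rewrite degleP; apply: leq_trans (leq_bigmax a); apply: leq_trans (leq_bigmax b).
Qed.

Section Generators.
Variables (R : realType) (N m : nat) (G : 'M[{mpoly R[N]}]_m) (c : nat).

Lemma sphere_qm_sos_scalar l k s : sphere_sos k s ->
  sphere_qm G c k (fun z => (s z)%:M : 'M[R]_l).
Proof.
move=> hs; have I1 : sphere_qm G c 0 (fun=> 1%:M : 'M[R]_l).
  apply: sphere_qm_psd; first exact: tr_scalar_mx.
  by move=> v; rewrite -/(qform _ v) qform_scalar mul1r sqnorm_ge0.
have := sphere_qm_sosM hs I1; rewrite addn0; apply: eq_sphere_qm => z _.
by rewrite scalemx1.
Qed.

(** For a scalar a, the matrix a I is the sum over j of e_j^T a e_j, where e_j is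
    a row of the identity. *)
Lemma sphere_qm_gen_scalar l k (P : 'M[{mpoly R[N]}]_(m, 1)) :
  (forall a b, degle k (P a b)) ->
  sphere_qm G c (k + c) (fun z => ((mxeval (P^T *m G *m P) z) 0 0)%:M : 'M[R]_l).
Proof.
move=> hP; pose e (j : 'I_l) : 'M[{mpoly R[N]}]_(1, l) := delta_mx 0 j.
have := sphere_qm_sum (index_enum 'I_l) (G := G) (c := c) (k := k + c)
  (F := fun j z => (mxeval (P *m e j) z)^T *m mxeval G z *m mxeval (P *m e j) z).
move=> /(_ _)H; apply: eq_sphere_qm _ (H _) => [z _|j]; last first.
  apply: sphere_qm_gen => a b; rewrite mxE big_ord1 mxE eqxx /=.
  by case: (b == j); rewrite ?mulr1 ?mulr0 ?degle0.
have e1 j : mxeval (e j) z = delta_mx 0 j.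
  by apply/matrixP => a b; rewrite !mxE; case: (_ && _); rewrite ?meval1 ?meval0.
rewrite -scalemx1 mx1_sum_delta scaler_sumr; apply: eq_bigr => j _.
rewrite mxevalM trmx_mul e1 trmx_delta.
have -> : delta_mx j 0 *m (mxeval P z)^T *m mxeval G z *m (mxeval P z *m delta_mx 0 j) =
    delta_mx j 0 *m mxeval (P^T *m G *m P) z *m delta_mx 0 j :> 'M[R]_l.
  by rewrite !mxevalM mxevalT !mulmxA.
by rewrite [mxeval _ z in LHS]mx11_scalar mul_mx_scalar -scalemxAl mul_delta_mx.
Qed.

Lemma sphere_qm_of_QM1 l k (d : {mpoly R[N]}) : QM G 1%N k d%:M ->
  exists e : nat, sphere_qm G c e (fun z => d.@[z 0]%:M : 'M[R]_l).
Proof.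
move=> [s [Q [t [P [_ _ dE]]]]].
pose e := (\max_i mxdeg (Q i) + \max_i mxdeg (P i) + c)%N; exists e.
have Qe i : sphere_qm G c e (fun z => ((Q i 0 0).@[z 0] ^+ 2)%:M : 'M[R]_l).
  apply: sphere_qm_sos_scalar; apply: sphere_sos_sqr; apply: degle_le (degle_mxdeg _ _ _).
  by rewrite /e -addnA; apply: leq_trans (leq_addr _ _); apply: (leq_bigmax i).
have Pe i : sphere_qm G c e (fun z => (mxeval ((P i)^T *m G *m P i) z 0 0)%:M : 'M[R]_l).
  apply: sphere_qm_le (sphere_qm_gen_scalar l (k := \max_i mxdeg (P i)) _).
    by rewrite leq_add2r leq_addl.
  by move=> a b; apply: degle_le (degle_mxdeg _ _ _); apply: (leq_bigmax i).
apply: eq_sphere_qm _ (sphere_qmD (sphere_qm_sum (index_enum 'I_s) Qe)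
  (sphere_qm_sum (index_enum 'I_t) Pe)) => z _.
rewrite -!(raddf_sum (@scalar_mx R l)) -raddfD; congr (_%:M).
have -> : d.@[z 0] = mxeval (d%:M : 'M_1) z 0 0 by rewrite !mxE mulr1n.
rewrite dE mxevalD !mxeval_sum [RHS]mxE !summxE; congr (_ + _).
by apply: eq_bigr => i _; rewrite mxevalM mxevalT [RHS]mxE big_ord1 !mxE expr2.
Qed.

End Generators.

Section LargeConstant.
Variables (R : realType) (N m : nat) (G : 'M[{mpoly R[N]}]_m) (c : nat).

Lemma mnm_split (a : 'X_{1..N}) k : (k <= mdeg a)%N ->
  exists b b', a = (b + b')%MM /\ mdeg b = k.
Proof.
elim: k => [|k IH] ka; first by exists 0%MM, a; rewrite add0m mdeg0.
have [b [b' [e eb]]] := IH (ltnW ka).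
have : mdeg b' != 0.
  by apply: contraTneq ka => b'0; rewrite e mdegD eb b'0 addn0 ltnn.
rewrite mdegE sum_nat_eq0 negb_forall => /existsP[i /= b'i].
exists (b + U_(i))%MM, (b' - U_(i))%MM; split; last by rewrite mdegD mdeg1 eb addn1.
by rewrite e -addmA; congr (_ + _)%MM; rewrite addmC submK // lep1mP.
Qed.

(** On the sphere, 1 - z_i^2 q^2 = sum_(j <> i) z_j^2 + z_i^2 (1 - q^2). *)
Lemma sphere_sos_monomial (a : 'X_{1..N}) :
  sphere_sos (mdeg a) (fun z => 1 - ('X_[a] : {mpoly R[N]}).@[z 0] ^+ 2).
Proof.
move: {2}(mdeg a) (erefl (mdeg a)) => k; elim: k a => [|k IH] a ka.
  apply: eq_sphere_sos _ (sphere_sosC N _ (lexx 0)) => z _.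
  by move/eqP: ka; rewrite mdeg_eq0 => /eqP ->; rewrite mpolyX0 meval1 expr1n subrr.
have a1 : (1 <= mdeg a)%N by rewrite ka.
have [b [b' [e eb]]] := mnm_split a1.
have /mdeg1P[i /eqP bi] : mdeg b == 1 by rewrite eb.
have kb' : mdeg b' = k by move: ka; rewrite e mdegD eb => -[].
rewrite ka -add1n.
have X1 (j : 'I_N) : degle 1 ('X_j : {mpoly R[N]}) by apply: degleX.
have s1 : sphere_sos 1 (fun z : 'rV[R]_N => \sum_(j | j != i) ('X_j).@[z 0] ^+ 2).
  by apply: sphere_sos_sum => j _; apply: sphere_sos_sqr.
have s2 := sphere_sosM (sphere_sos_sqr (X1 i)) (IH b' kb'); rewrite kb' in s2.
apply: eq_sphere_sos _ (sphere_sosD (sphere_sos_le _ s1) s2) => [z hz|//].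
rewrite e bi mpolyXD mevalM mevalXU.
under eq_bigr => j _ do rewrite mevalXU.
move: hz; rewrite /unit_sphere (bigD1 i) //= => /eqP; rewrite eq_sym addrC -subr_eq => /eqP <-.
by ring.
Qed.

(** Meant for large eps, where the degree of the certificate cannot exceed that
    of f. *)
Definition near_qm l k (A : 'rV[R]_N -> 'M[R]_l) :=
  exists2 B : R, 0 <= B & sphere_qm G c k (fun z => A z + B%:M).

Lemma near_qm_sum l k (I : Type) (r : seq I) (F : I -> 'rV[R]_N -> 'M[R]_l) :
  (forall i, near_qm k (F i)) -> near_qm k (fun z => \sum_(i <- r) F i z).
Proof.
move=> h; elim: r => [|i r [B B0 hB]].
  exists 0 => //; apply: eq_sphere_qm _ (sphere_qm0 G c l k) => z _.
  by rewrite big_nil raddf0 addr0.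
have [B' B'0 hB'] := h i; exists (B' + B); first exact: addr_ge0.
apply: eq_sphere_qm _ (sphere_qmD hB' hB) => z _.
by rewrite big_cons raddfD /= addrACA.
Qed.

Lemma near_qmZ l k (s : R) (A : 'rV[R]_N -> 'M[R]_l) : 0 <= s ->
  near_qm k A -> near_qm k (fun z => s *: A z).
Proof.
move=> s0 [B B0 hB]; exists (s * B); first exact: mulr_ge0.
have := sphere_qm_sosM (sphere_sosC N 0 s0) hB; rewrite add0n.
by apply: eq_sphere_qm => z _; rewrite scalerDr scale_scalar_mx.
Qed.

(** Expanding the square of p E_aa + s q E_ab gives the left side plus
    p^2 E_aa + q^2 E_bb, and p^2 and q^2 are at most 1 modulo sums of
    squares. *)
Lemma near_qm_cross l k (p q : {mpoly R[N]}) (s : R) (a b : 'I_l) :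
  degle k p -> degle k q ->
  sphere_sos k (fun z => 1 - p.@[z 0] ^+ 2) -> sphere_sos k (fun z => 1 - q.@[z 0] ^+ 2) ->
  s ^+ 2 = 1 ->
  near_qm k (fun z => (s * (p.@[z 0] * q.@[z 0])) *: (delta_mx a b + delta_mx b a : 'M[R]_l)).
Proof.
move=> dp dq sp sq s1; exists 2 => //.
pose Q : 'M[{mpoly R[N]}]_l := p *: delta_mx a a + (s *: q) *: delta_mx a b.
have degQ i j : degle k (Q i j).
  rewrite !mxE; apply: degleD; case: (_ && _); rewrite ?mulr1 ?mulr0 //; try exact: degle0.
  exact: degleZ.
have Ed (i : 'I_l) k' : sphere_qm G c k' (fun=> delta_mx i i : 'M[R]_l).
  have := sphere_qm_sqr G c (k := k') (Q := map_mx (mpolyC N (R := R)) (delta_mx i i : 'M[R]_l)) _.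
  move=> /(_ _)H; apply: eq_sphere_qm _ (H _) => [z _|? ?]; last by rewrite mxE degleC.
  by rewrite mxevalC trmx_delta mul_delta_mx.
have Ec (i : 'I_l) : sphere_qm G c k (fun=> 1%:M - delta_mx i i : 'M[R]_l).
  have H := sphere_qm_sum (enum (predC1 i)) (fun j => Ed j k).
  apply: eq_sphere_qm _ H => z _.
  rewrite mx1_sum_delta [in RHS](bigD1 i) //= addrAC subrr add0r.
  by rewrite big_enum.
have T1 := sphere_qm_sosM sp (Ed a 0); have T2 := sphere_qm_sosM sq (Ed b 0).
rewrite addn0 in T1; rewrite addn0 in T2.
apply: eq_sphere_qm _ (sphere_qmD (sphere_qm_sqr G c degQ)
  (sphere_qmD (sphere_qmD T1 T2) (sphere_qmD (Ec a) (Ec b)))) => z _.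
have dE (i j : 'I_l) : mxeval (delta_mx i j : 'M[{mpoly R[N]}]_l) z = delta_mx i j.
  by apply/matrixP => i' j'; rewrite !mxE; case: (_ && _); rewrite ?meval1 ?meval0.
rewrite /Q mxevalD !mxevalZ mevalZ !dE.
move: (p.@[z 0]) (q.@[z 0]) => x y.
rewrite [(_ + _)^T]linearD /= ![(_ *: _)^T]linearZ /= !trmx_delta.
rewrite !(mulmxDl, mulmxDr) -!scalemxAl -!scalemxAr !scalerA !mul_delta_mx.
rewrite (_ : 2%:M = 1%:M + 1%:M :> 'M[R]_l); last by rewrite -raddfD.
apply/matrixP => i j; rewrite !mxE.
have -> : s * y * (s * y) = s ^+ 2 * (y * y) by ring.
by rewrite s1; ring.
Qed.

Lemma near_qm_monomial l h (a : 'X_{1..N}) (t : R) (i j : 'I_l) :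
  (mdeg a <= 2 * h)%N ->
  near_qm h (fun z => (t * ('X_[a] : {mpoly R[N]}).@[z 0]) *:
                      (delta_mx i j + delta_mx j i : 'M[R]_l)).
Proof.
move=> ah.
(* A product of two monomials of degree at most h. *)
have [b [b' [e eb]]] := @mnm_split a (minn h (mdeg a)) (geq_minr _ _).
have bh : (mdeg b <= h)%N by rewrite eb geq_minl.
have b'h : (mdeg b' <= h)%N by move: ah eb; rewrite e mdegD; lia.
pose s : R := if 0 <= t then 1 else -1.
have s1 : s ^+ 2 = 1 by rewrite /s; case: ifP => _; rewrite ?sqrrN expr1n.
have ts : t = `|t| * s.
  rewrite /s; case: (leP 0 t) => t0; first by rewrite ger0_norm ?mulr1.
  by rewrite ltr0_norm // mulrN1 opprK.
have H := near_qm_cross i j (degleXm R bh) (degleXm R b'h)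
  (sphere_sos_le bh (sphere_sos_monomial b)) (sphere_sos_le b'h (sphere_sos_monomial b')) s1.
have [B B0 hB] := near_qmZ (normr_ge0 t) H.
exists B => //; apply: eq_sphere_qm _ hB => z _.
by rewrite e mpolyXD mevalM scalerA {2}ts; congr (_ *: _ + _); ring.
Qed.

Lemma near_qm_poly l h (f : 'M[{mpoly R[N]}]_l) : f^T = f ->
  (forall i j, degle (2 * h) (f i j)) ->
  exists2 B : R, 0 <= B & forall eps, B <= eps ->
    sphere_qm G c h (fun z => mxeval f z + eps%:M).
Proof.
move=> symf degf.
have H : near_qm h (fun z => \sum_(p : 'I_l * 'I_l) \sum_(a <- msupp (f p.1 p.2))
   if (mdeg a <= 2 * h)%N then ((f p.1 p.2)@_a / 2 * ('X_[a] : {mpoly R[N]}).@[z 0]) *: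
   (delta_mx p.1 p.2 + delta_mx p.2 p.1 : 'M[R]_l) else 0).
  apply: near_qm_sum => p; apply: near_qm_sum => a.
  case ah: (mdeg a <= 2 * h)%N; first exact: near_qm_monomial.
  exists 0 => //; apply: eq_sphere_qm _ (sphere_qm0 G c l h) => z _.
  by rewrite raddf0 addr0.
have [B B0 hB] := H; exists B => // eps Be.
have eB : 0 <= eps - B by rewrite subr_ge0.
apply: eq_sphere_qm _ (sphere_qmD hB (sphere_qm_sos_scalar G c l (sphere_sosC N h eB))) => z _.
rewrite -addrA -raddfD /= [B + _]addrC subrK; congr (_ + _).
have E (p : 'I_l * 'I_l) : \sum_(a <- msupp (f p.1 p.2))
   (if (mdeg a <= 2 * h)%N then ((f p.1 p.2)@_a / 2 * ('X_[a] : {mpoly R[N]}).@[z 0]) *: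
   (delta_mx p.1 p.2 + delta_mx p.2 p.1 : 'M[R]_l) else 0) =
   (mxeval f z p.1 p.2 / 2) *: (delta_mx p.1 p.2 + delta_mx p.2 p.1).
  rewrite mxE [in RHS]mevalE mulr_suml scaler_suml big_seq [RHS]big_seq.
  apply: eq_bigr => a ap; rewrite ifT; last first.
    by rewrite -ltnS; apply: leq_trans (msize_mdeg_lt ap) (degf _ _).
  by rewrite mevalX mulrAC.
under eq_bigr => p _ do rewrite E.
rewrite -(pair_bigA _ (fun i j => (mxeval f z i j / 2) *: (delta_mx i j + delta_mx j i))) /=.
rewrite [RHS]matrix_sum_delta.
under eq_bigr => i _ do under eq_bigr => j _ do rewrite scalerDr.
under eq_bigr => i _ do rewrite big_split.
rewrite big_split /= [X in _ + X]exchange_big -big_split /=; apply: eq_bigr => i _.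
rewrite -big_split /=; apply: eq_bigr => j _.
have -> : mxeval f z j i = mxeval f z i j by rewrite -[in LHS]symf mxevalT mxE.
by rewrite -scalerDl; congr (_ *: _); field.
Qed.

End LargeConstant.

(** * The Lojasiewicz inequality *)

Section Geometry.
Variables (R : realType) (n : nat).
Local Notation N := n.+1.

Lemma coef_tree_mpoly_family (I : finType) (q : I -> {mpoly R[N]}) :
  exists (D : nat) (L : R), 0 <= L /\
    forall i, coef_tree (@bary R n) D (- L) L (fun z => (q i).@[z 0]).
Proof.
have [D /fin_all_exists [L h]] := fin_all_exists (fun i => coef_tree_mpoly (q i)).
exists (\max_i D i)%N, (\sum_i L i); split.
  by apply: sumr_ge0 => i _; have [] := h i.
move=> i; have [_ hi] := h i.
have Li : L i <= \sum_i L i.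
  by rewrite (bigD1 i) //= lerDl sumr_ge0 // => j _; have [] := h j.
apply: (coef_tree_le (@sum_bary R n) (leq_bigmax i)).
by apply: coef_tree_wide hi; rewrite ?lerN2.
Qed.

Definition edist2 (z z' : 'rV[R]_N) : R :=
  Num.sqrt (\sum_(i < N) (z 0 i - z' 0 i) ^+ 2).

Lemma qform_lipschitz l (f : 'M[{mpoly R[N]}]_l) e (Lf : R) z z' u :
  0 <= Lf ->
  (forall a b, coef_tree (@bary R n) e (- Lf) Lf (fun z => (f a b).@[z 0])) ->
  simplex z -> simplex z' ->
  `|qform (mxeval f z - mxeval f z') u|
    <= e%:R * Lf * (2 * N%:R) * l%:R * edist2 z z' * sqnorm u.
Proof.
move=> Lf0 repf hz hz'.
have -> : e%:R * Lf * (2 * N%:R) * l%:R * edist2 z z' =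
  e%:R * Lf * (2 * N%:R) * edist2 z z' * l%:R by ring.
have d0 : 0 <= edist2 z z' by apply: sqrtr_ge0.
apply: qform_bound; first by rewrite !mulr_ge0.
move=> a b; rewrite [X in `|X|]mxE [X in _ + X]mxE !mxE.
apply: le_trans (coef_tree_lipschitz (@sum_bary R n) _ _ (repf a b)) _.
- by move=> i; apply: bary_ge0.
- by move=> i; apply: bary_ge0.
rewrite -[leRHS]mulrA; apply: ler_wpM2l; first exact: mulr_ge0.
apply: le_trans (bary_dist z z') _; rewrite -[leRHS]mulrA; apply: ler_wpM2l => //.
rewrite mulr_natl -[in leRHS](card_ord N) -sumr_const; apply: ler_sum => i _.
rewrite -sqrtr_sqr; apply: ler_wsqrtr.
by rewrite [leRHS](bigD1 i) //= lerDl sumr_ge0 // => j _; rewrite sqr_ge0.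
Qed.

(** Where z_0 <> 0, both matrices are even powers of z_0 times their values at
    the point z / z_0 of affine space; where z_0 = 0, all entries of the
    homogenization vanish. *)
Lemma psd_homogenize m l (G : 'M[{mpoly R[n]}]_m) (F : 'M[{mpoly R[n]}]_l) h :
  (forall x, psd_set G x -> psdmx (mxeval F x)) -> (mxdeg F < 2 * h)%N ->
  forall z, psd_set (Ghat G) z ->
  forall u, 0 <= qform (mxeval (map_mx (homogenize (2 * h)) F) z) u.
Proof.
move=> Fpsd Fh z Gz u.
have [z0|z0] := eqVneq (z 0 ord0) 0.
  suff -> : mxeval (map_mx (homogenize (2 * h)) F) z = 0.
    by rewrite /qform mulmx0 mul0mx mxE.
  apply/matrixP => a b; rewrite !mxE; apply: homogenize_infty => //.
  by apply: leq_trans Fh; apply: degle_mxdeg.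
pose x : 'rV[R]_n := \row_j ((z 0 ord0)^-1 * z 0 (lift ord0 j)).
have zE : z = hpoint (z 0 ord0)^-1 x.
  apply/rowP => i; rewrite mxE invrK; case: unliftP => [j ->|->]; rewrite ?mulr1 //.
  by rewrite mxE mulVKf.
have s0 : (z 0 ord0)^-1 != 0 by rewrite invr_eq0.
move: (_^-1) s0 zE => s s0 zE.
have even (M : 'M[R]_l) k : 0 <= qform (s ^+ (2 * k) *: M) u -> 0 <= qform M u.
  by rewrite qformZ pmulr_rge0 // exprM exprn_gt0 // lt_neqAle eq_sym sqrf_eq0 s0 sqr_ge0.
apply: (even _ h).
have -> : s ^+ (2 * h) *: mxeval (map_mx (homogenize (2 * h)) F) z = mxeval F x.
  apply/matrixP => a b; rewrite !mxE zE homogenizeE //.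
  by apply: degle_le (degle_mxdeg F a b); apply: ltnW.
apply: Fpsd => v; rewrite -(mxeval_Ghat G x s0) -zE -/(qform _ v) qformZ.
by apply: mulr_ge0; [rewrite exprM exprn_ge0 // sqr_ge0|apply: Gz].
Qed.

End Geometry.

Lemma calG_le (R : realType) N r (ds : 'I_r -> {mpoly R[N]}) (z : 'rV[R]_N) (t : R) :
  let b : {mpoly R[N]} := 1 - \sum_(i < N) 'X_i ^+ 2 in
  0 <= t ->
  (forall i, - t <= (ds i).@[z 0] / bernstein_norm (ds i)) ->
  - t <= b.@[z 0] / bernstein_norm b -> - t <= (- b).@[z 0] / bernstein_norm b ->
  calG ds z <= t.
Proof.
move=> b t0 h1 h2 h3; rewrite /calG -/b lerNl.
rewrite !le_min h2 h3 /= oppr_le0 t0 !andbT.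
elim/big_rec: _ => [|i x _ hx]; first by rewrite oppr_le0.
by rewrite le_min h1.
Qed.

Lemma bernstein_norm_ge0 (R : realType) N (p : {mpoly R[N]}) : 0 <= bernstein_norm p.
Proof.
rewrite /bernstein_norm; elim/big_rec: _ => // i x _ x0.
by rewrite le_max x0 orbT.
Qed.

Section Lojasiewicz.
Variables (R : realType) (n m r : nat) (G : 'M[{mpoly R[n]}]_m).
Variable ds : 'I_r -> {mpoly R[n.+1]}.
Local Notation N := n.+1.
Local Notation c0 := (uphalf (mxdeg G)).

Definition sphere_defect : {mpoly R[N]} := 1 - \sum_(i < N) 'X_i ^+ 2.

(** The functions whose negative parts [calG] measures. *)
Definition constraint (i : 'I_r + bool) : {mpoly R[N]} :=
  match i with
  | inl j => (bernstein_norm (ds j))^-1 *: ds j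
  | inr true => (bernstein_norm sphere_defect)^-1 *: sphere_defect
  | inr false => (bernstein_norm sphere_defect)^-1 *: (- sphere_defect)
  end.

Lemma constraint_calG (z : 'rV[R]_N) (t : R) : 0 <= t ->
  (forall i, - t <= (constraint i).@[z 0]) -> calG ds z <= t.
Proof.
move=> t0 h; apply: calG_le => //.
- by move=> i; have := h (inl i); rewrite /= mevalZ mulrC.
- by have := h (inr true); rewrite /= mevalZ mulrC.
- by have := h (inr false); rewrite /= mevalZ mulrC.
Qed.

Lemma constraint_sphere_qm l :
  (forall i, exists k, QM (Ghat G) 1%N k (ds i)%:M) ->
  forall i, exists e : nat,
    sphere_qm (Ghat G) c0 e (fun z => (constraint i).@[z 0]%:M : 'M[R]_l).
Proof.
move=> hds [j|b].
  have [k hk] := hds j; have [e he] := sphere_qm_of_QM1 c0 l hk; exists e.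
  have a0 : 0 <= (bernstein_norm (ds j))^-1 by rewrite invr_ge0 bernstein_norm_ge0.
  have := sphere_qm_sosM (sphere_sosC N 0 a0) he; rewrite add0n.
  by apply: eq_sphere_qm => z _; rewrite /= mevalZ scale_scalar_mx.
exists 0%N; apply: eq_sphere_qm _ (sphere_qm0 (Ghat G) c0 l 0) => z hz.
have s0 : sphere_defect.@[z 0] = 0.
  rewrite mevalB meval1 rmorph_sum /= -[X in X - _]hz -sumrB big1 // => i _.
  by rewrite rmorphXn /= mevalXU subrr.
by case: b; rewrite /= mevalZ ?mevalN s0 ?oppr0 mulr0 raddf0.
Qed.

(** Let Lam be a Lipschitz constant of f on the simplex and t = eps / (8 Lam).
    If calG z is small enough for the Lojasiewicz inequality to place z within
    t of Ktilde, then f is positive semidefinite at some point within 2 t of z,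
    and it changes by at most eps / 4 in between. *)
Lemma lojasiewicz_qform l (f : 'M[{mpoly R[N]}]_l) (eta : R) :
  Ktilde G !=set0 -> 0 < eta -> lojasiewicz_ineq G ds eta ->
  (forall z, psd_set (Ghat G) z -> forall u, 0 <= qform (mxeval f z) u) ->
  exists2 a : R, 0 < a <= 1 & forall eps, 0 < eps <= 1 -> forall z, simplex z ->
    (forall i, - (a * eps `^ eta) <= (constraint i).@[z 0]) ->
    forall u, - (eps / 4) * sqnorm u <= qform (mxeval f z) u.
Proof.
move=> K0 eta0 [kappa kappa0 loj] fpsd.
have [e [Lf [Lf0 repf]]] := coef_tree_mpoly_family (fun p : 'I_l * 'I_l => f p.1 p.2).
pose Lam : R := 1 + e%:R * Lf * (2 * N%:R) * l%:R.
have Lam1 : 1 <= Lam by rewrite lerDl !mulr_ge0.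
have kap1 : 0 < 1 + kappa by lra.
(* The denominator is not kappa itself, in order to have a <= 1. *)
pose a := (8 * Lam)^-1 `^ eta / (1 + kappa).
have L8 : 0 < (8 * Lam)^-1 <= 1 by apply/andP; split; [rewrite invr_gt0; lra|rewrite invf_le1; lra].
have /andP[L80 L81] := L8.
have b1 : 0 < (8 * Lam)^-1 `^ eta <= 1.
  rewrite powR_gt0 //=; apply: (@le_trans _ _ (1 `^ eta)); last by rewrite powR1.
  by apply: ge0_ler_powR; rewrite ?nnegrE // ltW.
have /andP[b0 b1'] := b1.
exists a; first by rewrite /a divr_gt0 //= ler_pdivrMr // mul1r; lra.
move=> eps /andP[p0 p1] z hz hg u.
have aE : a * eps `^ eta = (eps / (8 * Lam)) `^ eta / (1 + kappa).
  by rewrite /a mulrAC -powRM ?(ltW L80) ?(ltW p0) // [_^-1 * _]mulrC.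
set t := eps / (8 * Lam) in aE.
have t0 : 0 < t by rewrite divr_gt0 //; lra.
have tp0 : 0 < t `^ eta by rewrite powR_gt0.
have dist : edist z (Ktilde G) <= t.
  rewrite leNgt; apply/negP => td.
  have := loj z hz.1 hz.2; apply/negP; rewrite -ltNge.
  apply: (@le_lt_trans _ _ (t `^ eta)); last first.
    apply: gt0_ltr_powR; rewrite ?nnegrE // ltW //.
    exact: lt_trans td.
  have cG : calG ds z <= t `^ eta / (1 + kappa).
    apply: constraint_calG; first by rewrite divr_ge0 // ltW.
    by move=> i; rewrite -aE.
  apply: le_trans (ler_wpM2l (ltW kappa0) cG) _.
  rewrite mulrCA; apply: ler_piMr; first exact: ltW.
  by rewrite ler_pdivrMr // mul1r; lra.
have [y Ky yt] : exists2 y, Ktilde G y & edist2 z y < 2 * t.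
  have inf_E : has_inf [set Num.sqrt (\sum_(i < N) (z 0 i - y 0 i) ^+ 2) | y in Ktilde G].
    split; first by have [y Ky] := K0; exists (edist2 z y); exists y.
    by exists 0 => _ [y _ <-]; apply: sqrtr_ge0.
  have [_ [y Ky <-] hy] := inf_adherent t0 inf_E.
  exists y => //; apply: lt_le_trans hy _.
  by rewrite mulr_natl mulr2n lerD2r.
have hy : simplex y by apply: sphere_simplex; have [] := Ky.
have := qform_lipschitz u Lf0 (fun a b => repf (a, b)) hz hy.
have := fpsd y Ky.1 u; rewrite -[- mxeval f y]scaleN1r qformD qformZ mulN1r.
have N0 := sqnorm_ge0 u; set nm := sqnorm u in N0 *.
move=> h0; rewrite ler_norml => /andP[h _]; move: h.
have H : e%:R * Lf * (2 * N%:R) * l%:R * edist2 z y <= eps / 4.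
  apply: (@le_trans _ _ (Lam * (2 * t))).
    apply: ler_pM; rewrite ?sqrtr_ge0 ?(ltW yt) //; first by rewrite !mulr_ge0.
    by rewrite /Lam lerDr.
  by rewrite /t le_eqVlt; apply/orP; left; apply/eqP; field; lra.
have := ler_wpM2r N0 H; lra.
Qed.

End Lojasiewicz.

(** * The degree bound *)

Section SphereTheorem.
Variables (R : realType) (n m r : nat) (G : 'M[{mpoly R[n]}]_m).
Variable ds : 'I_r -> {mpoly R[n.+1]}.
Local Notation N := n.+1.
Local Notation c0 := (uphalf (mxdeg G)).

(** With del = a eps^eta / L, the bound on K del^7 eps^3 becomes a bound on
    K eps^(7 eta + 3).  The factor L brings the values of the constraints on
    the simplex into [-1, 1]. *)
Lemma sphere_certificate l (f : 'M[{mpoly R[N]}]_l) (eta : R) :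
  f^T = f -> Ktilde G !=set0 -> 0 < eta -> lojasiewicz_ineq G ds eta ->
  (forall i, exists k, QM (Ghat G) 1%N k (ds i)%:M) ->
  (forall z, psd_set (Ghat G) z -> forall u, 0 <= qform (mxeval f z) u) ->
  exists2 C : R, 0 < C & forall eps, 0 < eps <= 1 -> forall K : nat,
    C <= K%:R * eps `^ (7 * eta + 3) ->
    sphere_qm (Ghat G) c0 K (fun z => mxeval f z + eps%:M).
Proof.
move=> symf K0 eta0 loj hds fpsd.
have [Df [Lf [Lf0 repf]]] := coef_tree_mpoly_family (fun p : 'I_l * 'I_l => f p.1 p.2).
have [Dg [Lg [Lg0 repg]]] := coef_tree_mpoly_family (constraint ds).
have [eg qmg] := fin_all_exists (constraint_sphere_qm l hds).
have [a /andP[a0 a1] hloj] := lojasiewicz_qform K0 eta0 loj fpsd.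
pose L := 1 + Lg; have L1 : 1 <= L by rewrite lerDl.
have L0 : 0 < L by lra.
have LV : 0 <= L^-1 by rewrite invr_ge0 ltW.
pose g i := L^-1 *: constraint ds i.
pose e := (Df + Dg + \max_i eg i + \max_i mpdeg (constraint ds i) + 1)%N.
have e0 : (0 < e)%N by rewrite /e addn1.
have repf' i j : coef_tree (@bary R n) e (- Lf) Lf (fun z => (f i j).@[z 0]).
  have Le : (Df <= e)%N by rewrite /e -!addnA leq_addr.
  exact: (coef_tree_le (@sum_bary R n) Le (repf (i, j))).
have repg' i : coef_tree (@bary R n) e (-1) 1 (fun z => (g i).@[z 0]).
  have Le : (Dg <= e)%N by rewrite /e; lia.
  have LgL : L^-1 * Lg <= 1 by rewrite mulrC ler_pdivrMr // mul1r lerDr.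
  apply: eq_coef_tree
    (coef_tree_le (@sum_bary R n) Le (coef_tree_wide _ LgL (coef_treeZ LV (repg i)))).
    by move=> z; rewrite mevalZ.
  by rewrite mulrN lerN2.
have degg i : degle e (g i).
  apply: degleZ; rewrite degleP; have := @leq_bigmax _ (fun i => mpdeg (constraint ds i)) i.
  by rewrite /e /=; lia.
have qmg' i : sphere_qm (Ghat G) c0 e (fun z => (g i).@[z 0]%:M : 'M[R]_l).
  have H : sphere_qm (Ghat G) c0 e (fun z => (constraint ds i).@[z 0]%:M : 'M[R]_l).
    by apply: sphere_qm_le (qmg i); have := @leq_bigmax _ eg i; rewrite /e; lia.
  have := sphere_qm_sosM (sphere_sosC N 0 LV) H; rewrite add0n.
  by apply: eq_sphere_qm => z _; rewrite mevalZ scale_scalar_mx.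
have [C C0 core] := core_certificate symf e0 Lf0 repf' repg' degg qmg'.
have aL0 : 0 < a / L by rewrite divr_gt0.
exists (C / (a / L) ^+ 7); first by rewrite divr_gt0 ?exprn_gt0.
move=> eps heps K hK; have /andP[p0 p1] := heps.
have pe0 : 0 < eps `^ eta by rewrite powR_gt0.
have pe1 : eps `^ eta <= 1.
  apply: (@le_trans _ _ (1 `^ eta)); last by rewrite powR1.
  by apply: ge0_ler_powR; rewrite ?nnegrE // ltW.
apply: (core eps (a * eps `^ eta / L)) => //.
- rewrite divr_gt0 ?mulr_gt0 //= ler_pdivrMr // mul1r.
  by apply: le_trans L1; apply: mulr_ile1 => //; apply: ltW.
- move=> z hz hg; apply: (hloj eps heps z hz) => i; have := hg i.
  by rewrite mevalZ -mulNr [_ / L]mulrC ler_pM2l ?invr_gt0.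
- move: hK; rewrite ler_pdivrMr ?exprn_gt0 // => hK; apply: le_trans hK _.
  rewrite powRD; last by rewrite (gt_eqF p0) implybT.
  rewrite [7 * eta]mulrC powRrM !powR_mulrn ?(ltW pe0) ?(ltW p0) //.
  by rewrite le_eqVlt; apply/orP; left; apply/eqP; field; rewrite gt_eqF.
Qed.

End SphereTheorem.

Section Homogenization.
Variables (R : realType) (n l : nat).

Lemma degle_homogenize d (p : {mpoly R[n]}) : degle d p -> degle d (homogenize d p).
Proof.
move=> hp; rewrite /homogenize big_seq; apply: degle_sum => a ap.
have ad : (mdeg a <= d)%N by rewrite -ltnS; apply: leq_trans (msize_mdeg_lt ap) hp.
apply: degleZ; rewrite -{1}(subnKC ad); apply: degleM.
  by rewrite mdegE; apply: (@degle_monomial R n.+1 _ (fun i : 'I_n => lift ord0 i) a).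
by have := degle_exp (d - mdeg a) (degleX R (@ord0 n) (ltnSn 0)); rewrite muln1.
Qed.

Lemma QM_of_homogenized m (G : 'M[{mpoly R[n]}]_m) (F : 'M[{mpoly R[n]}]_l) h k (eps : R) :
  (mxdeg F <= 2 * h)%N ->
  sphere_qm (Ghat G) (uphalf (mxdeg G)) (k + h)
    (fun z => mxeval (map_mx (homogenize (2 * h)) F) z + eps%:M) ->
  QM G l (2 * k + 2 * h)%N
    (onepsq R n ^+ k *: (F + (eps *: onepsq R n ^+ h)%:M)).
Proof.
move=> Fh H; rewrite -mulnDr; apply: (QM_of_sphere H) => s x hs.
have s0 : s != 0.
  by apply: contraTneq (onepsq_gt0 x) => s0; rewrite -hs s0 expr0n ltxx.
rewrite mxevalZ mxevalD mulnDr exprD -scalerA rmorphXn /= -hs -exprM.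
congr (_ *: _); rewrite scalerDr; congr (_ + _).
  apply/matrixP => a b; rewrite !mxE homogenizeE //.
  exact: degle_le (degle_mxdeg F a b).
apply/matrixP => a b; rewrite !mxE.
by case: (a == b); rewrite ?mulr1n ?mulr0n ?meval0 ?mulr0 // mevalZ rmorphXn /= -hs exprM mulrC.
Qed.

End Homogenization.

Theorem corollary1p3 (R : realType) (n m l : nat) (hm : (2 <= m)%N)
  (G : 'M[{mpoly R[n]}]_m) (symG : G^T = G)
  (Kt_neq0 : Ktilde G !=set0)
  (ds : 'I_(theta m) -> {mpoly R[n.+1]})
  (ds_QM : forall i,
     QM (Ghat G) 1%N (2 * 3 ^ (m - 1) * uphalf (mxdeg G))%N (ds i)%:M)
  (ds_psd : psd_set (Ghat G) =
            [set x : 'rV[R]_n.+1 | forall i, 0 <= (ds i).@[x 0]])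
  (eta : R) (heta : is_lojasiewicz_exponent G ds eta)
  (d : nat) (F : 'M[{mpoly R[n]}]_l) (symF : F^T = F) (degF : mxdeg F = d)
  (F_psd : forall x : 'rV[R]_n, psd_set G x -> psdmx (mxeval F x)) :
  exists2 C : R, 0 < C &
    forall eps : R, 0 < eps ->
    forall k : nat, C * eps `^ (- (7%:R * eta) - 3%:R) <= k%:R ->
      QM G l (2 * k + 2 * uphalf (d + 1))%N
        ((1 + \sum_(i < n) 'X_i ^+ 2) ^+ k *:
          (F + (eps *: (1 + \sum_(i < n) 'X_i ^+ 2) ^+ uphalf (d + 1)%N)%:M)).
Proof.
have [eta0 loj _] := heta.
set h := uphalf (d + 1).
have Fh : (mxdeg F < 2 * h)%N by rewrite degF /h uphalf_half; lia.
pose f := map_mx (homogenize (2 * h)) F.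
have symf : f^T = f by apply/matrixP => i j; rewrite !mxE -[in LHS]symF mxE.
have degf i j : degle (2 * h) (f i j).
  rewrite mxE; apply: degle_homogenize; apply: degle_le (degle_mxdeg F i j).
  exact: ltnW.
have dsQ i : exists k, QM (Ghat G) 1%N k (ds i)%:M.
  by exists (2 * 3 ^ (m - 1) * uphalf (mxdeg G))%N.
have [C C0 small] := sphere_certificate symf Kt_neq0 eta0 loj dsQ
  (psd_homogenize F_psd Fh).
have [B B0 large] := near_qm_poly (Ghat G) (uphalf (mxdeg G)) symf degf.
pose M := 1 + B; have M1 : 1 <= M by rewrite lerDl.
have M0 : 0 < M by lra.
pose p := 7 * eta + 3.
exists (C * M `^ p); first by rewrite mulr_gt0 ?powR_gt0.
move=> eps eps0 k hk; apply: QM_of_homogenized; first exact: ltnW.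
(* Below M, the certificate is built for eps / M <= 1, and the rest of eps is
   added as a multiple of the identity. *)
have [Me|eM] := leP M eps.
  by apply: sphere_qm_le (large eps _); [apply: leq_addl|rewrite (le_trans _ Me) // lerDr].
have eM0 : 0 < eps / M by rewrite divr_gt0.
have heps : 0 < eps / M <= 1 by rewrite eM0 ler_pdivrMr // mul1r ltW.
have eMe : eps / M <= eps by rewrite ler_pdivrMr // ler_peMr // ltW.
have H : sphere_qm (Ghat G) (uphalf (mxdeg G)) (k + h)
    (fun z => mxeval f z + (eps / M)%:M).
  apply: small heps _ _.
  move: hk; have -> : - (7%:R * eta) - 3%:R = - p by rewrite /p; ring.
  rewrite powRN ler_pdivrMr ?powR_gt0 // => hk.
  have epE : eps `^ p = (eps / M) `^ p * M `^ p.
    by rewrite -powRM ?(ltW eM0) ?(ltW M0) // divfK // gt_eqF.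
  move: hk; rewrite epE mulrA ler_pM2r ?powR_gt0 // => hk.
  apply: le_trans hk _; apply: ler_wpM2r; first exact: powR_ge0.
  by rewrite ler_nat leq_addr.
have eps1 : 0 <= eps - eps / M by rewrite subr_ge0.
apply: eq_sphere_qm _ (sphere_qmD H
  (sphere_qm_sos_scalar (Ghat G) (uphalf (mxdeg G)) l (sphere_sosC n.+1 (k + h) eps1))) => z _.
by rewrite -addrA -raddfD /= [eps / M + _]addrC subrK.
Qed.
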